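(* Let $p$ be a prime. A series $x\in\overline{\mathbb{F}}_p((t^{\mathbb{Q}}))$ is integral over $\overline{\mathbb{F}}_p((t))$ if and only if it is twist-recurrent.
   Context: Let $K=\overline{\mathbb{F}}_p$. $K((t^{\mathbb{Q}}))$ is the field of generalized (Hahn) power series $x=\sum_{i\in\mathbb{Q}}x_it^i$ with $x_i\in K$ and well-ordered support. For integers $a>0$, $b$, $c\ge0$, $S_{a,b,c}$ is the set of rationals $\frac1a(n-b_1p^{-1}-b_2p^{-2}-\cdots)$ with $n\ge-b$ an integer, $b_i\in\{0,\dots,p-1\}$, $\sum_ib_i\le c$; $T_c=S_{1,0,c}\cap(-1,0)$. A function $f:T_c\to K$ is twist-recurrent of order $k$ (a positive integer) if there exist $d_0,\dots,d_k\in K$, not all zero, such that $d_0c_n+d_1c_{n+1}^p+\cdots+d_kc_{n+k}^{p^k}=0$ for all $n\ge0$, for every sequence $c_n=f\bigl(-b_1p^{-1}-\cdots-b_{j-1}p^{-j+1}-p^{-n}(b_jp^{-j}+b_{j+1}p^{-j-1}+\cdots)\bigr)$ $(n\ge0)$ with $j$ a positive integer and $b_1,b_2,\ldots\in\{0,\dots,p-1\}$ not all zero, $\sum_ib_i\le c$. $x$ is twist-recurrent if: (a) $x$ is supported on some $S_{a,b,c}$; (b) for some such $a,b,c$ and each integer $m\ge-b$, the function $f_m:T_c\to K$, $f_m(z)=x_{(m+z)/a}$, is twist-recurrent of some order; (c) the functions $f_m$ span a finite-dimensional $K$-vector space. *)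

(* Defs.v *)
From HB Require Import structures.
From mathcomp Require Import all_boot all_order all_algebra.
From mathcomp Require Import boolp classical_sets fsbigop.
Set Implicit Arguments. Unset Strict Implicit. Unset Printing Implicit Defensive.
Import Order.TTheory GRing.Theory Num.Theory.
Local Open Scope classical_set_scope.
Local Open Scope ring_scope.

Definition is_alg_closure_Fp (p : nat) (K : closedFieldType) : Prop :=
  p \in [pchar K] /\
  forall x : K, exists P : {poly K},
    [/\ P != 0, forall i, exists m : nat, P`_i = m%:R & root P x].

(** Generalized power series: coefficient functions rat -> K.
    x = sum_q x q t^q.  Hahn series = well-ordered support. *)
Definition hsupp (K : closedFieldType) (x : rat -> K) : set rat :=
  [set q | x q != 0].

Definition well_ordered_supp (K : closedFieldType) (x : rat -> K) : Prop :=
  forall A : set rat, A `<=` hsupp x -> A !=set0 ->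
    exists2 m, A m & forall a, A a -> m <= a.

(** Product of generalized power series (the sum is finite whenever both
    supports are well ordered). *)
Definition hmul (K : closedFieldType) (x y : rat -> K) : rat -> K :=
  fun k => \sum_(i \in [set: rat]) x i * y (k - i).

Definition hone (K : closedFieldType) : rat -> K := fun k => (k == 0)%:R.

Definition hexp (K : closedFieldType) (x : rat -> K) (n : nat) : rat -> K :=
  iter n (hmul x) (@hone K).

Definition laurent (K : closedFieldType) (y : rat -> K) : Prop :=
  exists N : int, forall q, y q != 0 -> exists n : int, q = n%:~R /\ (N <= n)%R.

Definition integral_over_laurent (K : closedFieldType) (x : rat -> K) : Prop :=
  exists (n : nat) (a : nat -> rat -> K),
    (forall j, laurent (a j)) /\
    forall k, hexp x n k + \sum_(j < n) hmul (a j) (hexp x j) k = 0.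

Definition digval (p : nat) (bs : seq nat) : rat :=
  \sum_(i < size bs) (nth 0%N bs i)%:R / (p%:R) ^+ (i.+1).

Definition digits_ok (p c : nat) (bs : seq nat) : bool :=
  all (fun b => b < p)%N bs && (sumn bs <= c)%N.

Definition S_set (p a : nat) (b : int) (c : nat) : set rat :=
  [set q | exists (n : int) (bs : seq nat),
     [/\ (- b <= n)%R, digits_ok p c bs & q = (n%:~R - digval p bs) / a%:R]].

Definition T_set (p c : nat) : set rat :=
  [set q | S_set p 1 0 c q /\ -1 < q /\ q < 0].

(** The twisted argument
    -b_1 p^{-1} - ... - b_{j-1} p^{-j+1} - p^{-n}(b_j p^{-j} + b_{j+1} p^{-j-1} + ...),
    for j >= 1 given as j0 = j - 1 : nat (digits are 0-indexed in bs). *)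
Definition twist_arg (p : nat) (j0 : nat) (bs : seq nat) (n : nat) : rat :=
  - \sum_(i < size bs)
      (nth 0%N bs i)%:R / (p%:R) ^+ (i.+1 + (if (j0 <= i)%N then n else 0%N)).

(** f : T_c -> K (given as a function on rat, only evaluated on T_c) is
    twist-recurrent of order k. *)
Definition twist_recurrent_order (p c : nat) (K : closedFieldType)
    (f : rat -> K) (k : nat) : Prop :=
  exists d : nat -> K,
    (exists l, (l <= k)%N /\ d l != 0) /\
    forall (j0 : nat) (bs : seq nat),
      digits_ok p c bs -> (0 < sumn bs)%N ->
      forall n : nat,
        \sum_(l < k.+1) d l * (f (twist_arg p j0 bs (n + l))) ^+ (p ^ l) = 0.

Definition fm (K : closedFieldType) (x : rat -> K) (a : nat) (m : int) : rat -> K :=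
  fun z => x ((m%:~R + z) / a%:R).

Definition twist_recurrent (p : nat) (K : closedFieldType) (x : rat -> K) : Prop :=
  exists (a : nat) (b : int) (c : nat),
    [/\ (0 < a)%N,
        hsupp x `<=` S_set p a b c,
        (forall m : int, (- b <= m)%R ->
           exists k, (0 < k)%N /\ twist_recurrent_order p c (fm x a m) k) &
        (* the f_m (as functions on T_c) span a finite-dimensional K-space *)
        exists (r : nat) (g : 'I_r -> rat -> K),
          forall m : int, (- b <= m)%R ->
            exists coef : 'I_r -> K,
              forall z, T_set p c z -> fm x a m z = \sum_(i < r) coef i * g i z].

(* Main.v *)
(** Write [x_m(r) = x((m + r)/a)], [-1 < r <= 0], for the components of [x], and let the
    operators [theta_b f (r) = f((r - b)/p)^p], [0 <= b < p], act on functions of [r]; they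
    prepend the digit [b] to the expansion of [-r], and [w^p = \sum_b t^(-b/a) theta_b w].
    Both sides of the equivalence amount to: for some [a], all the components of [x] lie in a
    finite-dimensional space stable under every [theta_b] (and digit sums are bounded).

    Integral implies finite kernel. The powers [x^(p^i)] are linearly dependent over the field
    of Puiseux series, so [\sum_i A_i x^(p^i) = 0] with [A_0 <> 0] after extracting p-th roots.
    Such an equation has a nonzero Puiseux root [y] (first slope of the Newton polygon, then a
    recursion on the coefficients); with [x = y z], the series [z^p - z] satisfies an equation
    of smaller order, and finiteness of the kernel passes from [z^p - z] to [z].
    Finite kernel implies twist-recurrent: over the algebraic closure of F_p the matrix of
    [theta_0] has entries in a finite field, so its Frobenius-twisted powers repeat.

    Conversely, by a twist-recurrence a word of digits with a long run of zeros acts on [f_m]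
    like a combination of shorter words, and words with large digit sum act by zero; so the
    kernel is finite. If [w_1, ..., w_s] span a stable space then [w_i^p] is a Puiseux
    combination of the [w_j], hence each [w_i] is algebraic over the Puiseux series. *)

From HB Require Import structures.
Require Import Defs.
From mathcomp Require Import all_boot all_order all_algebra.
From mathcomp Require Import boolp classical_sets fsbigop.
From mathcomp Require Import ring lra zify.
Set Implicit Arguments. Unset Strict Implicit. Unset Printing Implicit Defensive.
Import Order.TTheory GRing.Theory Num.Theory.
Local Open Scope classical_set_scope.
Local Open Scope ring_scope.

(** * Hahn series *)

(** A twist-recurrence is tested on one function at a time, by inserting zeros at one place, a
    condition that is awkward under sums and products. Stable spaces are preserved by spans, by
    multiplication with Puiseux series and by change of denominator. On the algebraic side, additive
    relations have the same convenience: such a relation keeps its form under x = y z, so that roots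
    are split off one by one without a splitting field or a tower of extensions. Stability alone
    says nothing about supports. It is therefore accompanied by a bound on digit sums where the
    support of x has to be described, and by well-ordered supports where the spanning functions have
    to be Hahn series. Twist-recurrences ignore r = 0, so in the converse the function supported at
    0 joins the generators. *)

Definition well_ordered (A : set rat) : Prop :=
  forall B : set rat, B `<=` A -> B !=set0 ->
    exists2 m, B m & forall b, B b -> m <= b.

Definition sumset (A B : set rat) : set rat :=
  [set q | exists a b, [/\ A a, B b & q = a + b]].

Lemma well_ordered_sub (A B : set rat) : A `<=` B -> well_ordered B -> well_ordered A.
Proof. by move=> sAB woB C sCA; apply: woB => q /sCA /sAB. Qed.

(** Suppose [C] has no least element. [descend] goes below any [c] in [C] to a pair with [a] least
    possible and then [b] least for that [a]; every pair of smaller sum then has [b' < b]. The least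
    [b] of such pairs contradicts one more descent. *)
Lemma well_ordered_sumset (A B : set rat) : well_ordered A -> well_ordered B ->
    well_ordered (sumset A B).
Proof.
move=> woA woB C sC [c0 Cc0]; apply: contrapT => nomin.
pose P a b := [/\ A a, B b & C (a + b)].
have descend c : C c -> exists a b, [/\ P a b, a + b < c &
    forall a' b', P a' b' -> a' + b' < a + b -> b' < b].
  move=> Cc.
  have [c1 Cc1 ltc] : exists2 c1, C c1 & c1 < c.
    apply: contrapT => h; apply: nomin; exists c => // b Cb.
    by rewrite leNgt; apply/negP => ltb; apply: h; exists b.
  have [a1 [b1 [Aa1 Bb1 Ec1]]] := sC _ Cc1.
  pose PA := [set a | exists b, P a b /\ a + b < c].
  have [a [b2 [Pb2 ltb2]] mina] : exists2 m, PA m & forall b, PA b -> m <= b.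
    apply: woA; first by move=> q [b [[]]].
    by exists a1, b1; rewrite /P -Ec1.
  pose PB := [set b | P a b /\ a + b < c].
  have [b [Pb ltb] minb] : exists2 m, PB m & forall b, PB b -> m <= b.
    apply: woB; first by move=> q [[]].
    by exists b2.
  exists a, b; split=> // a' b' Pab' lt'.
  have ltc' := lt_trans lt' ltb.
  have lea : a <= a' by apply: mina; exists b'.
  have [E|ne] := eqVneq a a'.
    by subst a'; have := minb b' (conj Pab' ltc'); lra.
  have : a < a' by rewrite lt_neqAle ne.
  lra.
pose G := [set b | exists a, P a b /\
    forall a' b', P a' b' -> a' + b' < a + b -> b' < b].
have [b [a [Pab good]] minb] : exists2 m, G m & forall b, G b -> m <= b.
  apply: woB; first by move=> q [a [[]]].
  by have [a [b [Pab _ g]]] := descend _ Cc0; exists b, a.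
case: (Pab) => _ _ Cab; have [a1 [b1 [P1 lt1 g1]]] := descend _ Cab.
have := good _ _ P1 lt1; have : b <= b1 by apply: minb; exists a1.
lra.
Qed.

(** If some initial segment is infinite, take the least [m] at which this happens. The elements
    below [m], if any, have a largest one [l], and the segment up to [l] is finite; adding [m] keeps
    it finite. *)
Lemma well_ordered_both_finite (I : set rat) : well_ordered I ->
    well_ordered [set - q | q in I] ->
  exists s : seq rat, uniq s /\ forall q, I q -> q \in s.
Proof.
move=> woI awoI.
pose fin (q : rat) := exists s : seq rat, forall i, I i -> i <= q -> i \in s.
suff [s sP] : exists s : seq rat, forall i, I i -> i \in s.
  by exists (undup s); rewrite undup_uniq; split=> // q /sP; rewrite mem_undup.
have maxI (J : set rat) : J `<=` I -> J !=set0 ->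
    exists2 m, J m & forall b, J b -> b <= m.
  move=> sJ [j Jj]; have [||m [m' Jm' <-] mP] := awoI [set - q | q in J].
  - by move=> q [q' /sJ ? <-]; exists q'.
  - by exists (- j), j.
  exists m' => // b Jb; have : - m' <= - b by apply: mP; exists b.
  by rewrite lerN2.
have allfin q : I q -> fin q.
  move=> Iq0; apply: contrapT => nf0.
  have [||m [Im nfm] mP] := woI (I `&` [set q | ~ fin q]).
  - by move=> ? [].
  - by exists q.
  have [[j [Ij ltj]]|none] := pselect (exists j, I j /\ j < m); last first.
    apply: nfm; exists [:: m] => i Ii lei; rewrite inE.
    case: (ltgtP i m) lei => // lti _; by case: none; exists i.
  have [||l [Il ltl] lP] := maxI (I `&` [set q | q < m]).
  - by move=> ? [].
  - by exists j.
  have [s sP] : fin l.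
    apply: contrapT => nfl; have : m <= l by apply: mP.
    by rewrite leNgt ltl.
  apply: nfm; exists (m :: s) => i Ii lei; rewrite inE.
  case: (ltgtP i m) lei => //= lti _; apply: sP => //; exact: lP.
have [[i Ii]|none] := pselect (I !=set0); last first.
  by exists [::] => i Ii; case: none; exists i.
have [m Im mP] := maxI I (fun _ h => h) (ex_intro _ i Ii).
by have [s sP] := allfin m Im; exists s => j Ij; apply: sP => //; apply: mP.
Qed.

(** The contributing [i] form a well-ordered set, and so do their opposites, because [k - i] ranges
    over a part of [B]. *)
Lemma well_ordered_convolution_finite (A B : set rat) (k : rat) : well_ordered A ->
    well_ordered B ->
  exists s : seq rat, uniq s /\ forall i, A i -> B (k - i) -> i \in s.
Proof.
move=> woA woB.
have [||s [us sP]] := @well_ordered_both_finite (A `&` [set i | B (k - i)]).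
- by apply: well_ordered_sub woA => ? [].
- move=> C sC [c Cc].
  have [||m [i Ci Em] mP] := woB [set k + i | i in C].
  + by move=> _ [i /sC [j [_ Bj] <-] <-].
  + by exists (k + c), c.
  exists i => // b Cb; have : m <= k + b by apply: mP; exists b.
  by rewrite -Em lerD2l.
by exists s; split=> // i Ai Bi; apply: sP.
Qed.

Section HahnRing.
Variable K : closedFieldType.
Implicit Types x y z : rat -> K.

(** Products are computed through this lemma: the list may be any one that contains the contributing
    exponents, so both sides of an identity can be brought to a common list. *)
Lemma hmul_seq x y k (s : seq rat) : uniq s ->
  (forall i, x i != 0 -> y (k - i) != 0 -> i \in s) ->
  hmul x y k = \sum_(i <- s) x i * y (k - i).
Proof.
move=> us sP; rewrite /hmul [RHS]fsbig_seq //; apply/esym/fsbig_widen => //.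
move=> i [_ /= nin]; apply/eqP; rewrite mulf_eq0.
by apply/negPn/negP; rewrite negb_or => /andP [xi yi]; apply: nin; exact: sP.
Qed.

Lemma hmul_neq0 x y k : hmul x y k != 0 -> sumset (hsupp x) (hsupp y) k.
Proof.
move=> nz; apply: contrapT => no; move/negP: nz; apply; apply/eqP.
rewrite (@hmul_seq x y k [::]) ?big_nil // => i xi yi; case: no.
by exists i, (k - i); split=> //; lra.
Qed.

Lemma well_ordered_hmul x y : well_ordered (hsupp x) -> well_ordered (hsupp y) ->
    well_ordered (hsupp (hmul x y)).
Proof.
move=> wx wy; apply: well_ordered_sub (well_ordered_sumset wx wy) => k; exact: hmul_neq0.
Qed.

Lemma hmulC x y : well_ordered (hsupp x) -> well_ordered (hsupp y) -> hmul x y = hmul y x.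
Proof.
move=> wx wy; apply/funext => k.
have [s [us sP]] := well_ordered_convolution_finite k wx wy.
rewrite (@hmul_seq x y k s) // (@hmul_seq y x k [seq k - i | i <- s]).
- by rewrite big_map; apply: eq_bigr => i _; rewrite mulrC subKr.
- by rewrite map_inj_uniq // => i j; lra.
move=> i yi xi; apply/mapP; exists (k - i); last by lra.
by apply: sP => //; rewrite /hsupp /= subKr.
Qed.

Lemma hmulDl x y z : well_ordered (hsupp x) -> well_ordered (hsupp y) -> well_ordered (hsupp z) ->
  hmul (fun q => x q + y q) z = (fun q => hmul x z q + hmul y z q).
Proof.
move=> wx wy wz; apply/funext => k.
have [s [_ sP]] := well_ordered_convolution_finite k wx wz.
have [t [_ tP]] := well_ordered_convolution_finite k wy wz.
have in1 i : x i != 0 -> z (k - i) != 0 -> i \in undup (s ++ t).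
  by move=> xi zi; rewrite mem_undup mem_cat sP.
have in2 i : y i != 0 -> z (k - i) != 0 -> i \in undup (s ++ t).
  by move=> xi zi; rewrite mem_undup mem_cat tP ?orbT.
rewrite !(@hmul_seq _ z k (undup (s ++ t))) ?undup_uniq //.
  by rewrite -big_split; apply: eq_bigr => i _; rewrite mulrDl.
move=> i xyi zi; have [xi|xi] := eqVneq (x i) 0; last exact: in1.
by apply: in2 => //; move: xyi; rewrite xi add0r.
Qed.

Lemma hmulA x y z : well_ordered (hsupp x) -> well_ordered (hsupp y) -> well_ordered (hsupp z) ->
  hmul x (hmul y z) = hmul (hmul x y) z.
Proof.
move=> wx wy wz; apply/funext => k.
have [I [uI IP]] := well_ordered_convolution_finite k wx (well_ordered_sumset wy wz).
have [L [uL LP]] := well_ordered_convolution_finite k (well_ordered_sumset wx wy) wz.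
rewrite (@hmul_seq x _ k I) //; last first.
  by move=> i xi /hmul_neq0; exact: IP.
rewrite (@hmul_seq _ z k L) //; last by move=> i /hmul_neq0; exact: LP.
(* Indexing by the exponent [i] of [x] and by the sum [l] of the exponents of [x] and [y] turns both
   sides into sums over the same rectangle. *)
transitivity (\sum_(i <- I) \sum_(l <- L) x i * y (l - i) * z (k - l)).
  apply: eq_bigr => i _; have [->|xi] := eqVneq (x i) 0.
    by rewrite mul0r big1 // => l _; rewrite !mul0r.
  rewrite (@hmul_seq y z (k - i) [seq l - i | l <- L]).
  - rewrite big_map mulr_sumr; apply: eq_bigr => l _.
    by rewrite mulrA; congr (_ * z _); lra.
  - by rewrite map_inj_uniq // => l m; lra.
  move=> j yj zj; apply/mapP; exists (i + j); last by lra.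
  by apply: LP; [exists i, j | rewrite /hsupp /= opprD addrA].
rewrite exchange_big; apply: eq_bigr => l _ /=.
have [->|zl] := eqVneq (z (k - l)) 0.
  by rewrite mulr0 big1 // => i _; rewrite mulr0.
rewrite (@hmul_seq x y l I) // ?mulr_suml // => i xi yi.
by apply: IP => //; exists (l - i), (k - l); split=> //; lra.
Qed.

(** The condition is stored as a boolean, so that two series with the same coefficients are equal
    ([hahnP]). *)
Record hahn := Hahn { hfun :> rat -> K; _ : `[< well_ordered (hsupp hfun) >] }.
HB.instance Definition _ := [isSub for hfun].
HB.instance Definition _ := [Choice of hahn by <:].

Lemma hahn_well_ordered (x : hahn) : well_ordered (hsupp x).
Proof. by case: x => x /= /asboolP. Qed.

Lemma hahnP (x y : hahn) : (forall q, x q = y q) -> x = y.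
Proof. by move=> e; apply: val_inj; apply/funext. Qed.

Definition mkhahn x (wx : well_ordered (hsupp x)) : hahn := Hahn (introT (asboolP _) wx).

Lemma well_ordered_single (c : rat) (A : set rat) : A `<=` [set c] -> well_ordered A.
Proof.
move=> sA B sB [b Bb]; exists c; first by rewrite -(sA _ (sB _ Bb)).
by move=> b' /sB /sA ->.
Qed.

Fact well_ordered_monomial (v : rat) (c : K) : well_ordered (hsupp (fun q =>
    if q == v then c else 0)).
Proof.
apply: (@well_ordered_single v) => q; rewrite /hsupp /=; have [->//|_] := eqVneq q v.
by rewrite eqxx.
Qed.
Definition monomial v c := mkhahn (@well_ordered_monomial v c).

Fact well_ordered_zero : well_ordered (hsupp (fun _ : rat => 0 : K)).
Proof. by apply: (@well_ordered_single 0) => q; rewrite /hsupp /= eqxx. Qed.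
Definition hahn0 := mkhahn (@well_ordered_zero).

Fact well_ordered_add x y : well_ordered (hsupp x) -> well_ordered (hsupp y) ->
    well_ordered (hsupp (fun q => x q + y q)).
Proof.
move=> wx wy B sB [b Bb].
have key (A : set rat) : well_ordered A -> (exists2 m, (B `&` A) m & forall b, (B `&` A) b ->
    m <= b)
    \/ (forall b, B b -> ~ A b).
  move=> wA; have [[q [Bq Aq]]|no] := pselect ((B `&` A) !=set0).
    by left; apply: wA; [move=> ? [] | exists q].
  by right => q Bq Aq; apply: no; exists q.
have sB' q : B q -> hsupp x q \/ hsupp y q.
  move=> /sB; rewrite /hsupp /=; have [->|] := eqVneq (x q) 0; last by left.
  by rewrite add0r; right.
case: (key _ wx) => [[m [Bm Am] mP]|nox].
  case: (key _ wy) => [[n [Bn An] nP]|noy].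
    have [le|lt] := leP m n.
      exists m => // q Bq; case: (sB' q Bq) => Aq; first by apply: mP.
      by apply: le_trans le _; apply: nP.
    exists n => // q Bq; case: (sB' q Bq) => Aq; last by apply: nP.
    by apply: le_trans (ltW lt) _; apply: mP.
  exists m => // q Bq; case: (sB' q Bq) => Aq; first by apply: mP.
  by case: (noy q Bq).
case: (key _ wy) => [[n [Bn An] nP]|noy].
  exists n => // q Bq; case: (sB' q Bq) => Aq; last by apply: nP.
  by case: (nox q Bq).
by case: (sB' b Bb) => [/(nox b Bb)|/(noy b Bb)].
Qed.
Definition hahn_add (x y : hahn) := mkhahn (@well_ordered_add x y (@hahn_well_ordered x)
    (@hahn_well_ordered y)).

Fact well_ordered_opp x : well_ordered (hsupp x) -> well_ordered (hsupp (fun q => - x q)).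
Proof. by apply: well_ordered_sub => q; rewrite /hsupp /= oppr_eq0. Qed.
Definition hahn_opp (x : hahn) := mkhahn (@well_ordered_opp x (@hahn_well_ordered x)).

Fact hahn_addA : associative hahn_add.
Proof. by move=> x y z; apply: hahnP => q /=; rewrite addrA. Qed.
Fact hahn_addC : commutative hahn_add.
Proof. by move=> x y; apply: hahnP => q /=; rewrite addrC. Qed.
Fact hahn_add0 : left_id hahn0 hahn_add.
Proof. by move=> x; apply: hahnP => q /=; rewrite add0r. Qed.
Fact hahn_addN : left_inverse hahn0 hahn_opp hahn_add.
Proof. by move=> x; apply: hahnP => q /=; rewrite addNr. Qed.
HB.instance Definition _ :=
  GRing.isZmodule.Build hahn hahn_addA hahn_addC hahn_add0 hahn_addN.

Definition hahn_mul (x y : hahn) := mkhahn (@well_ordered_hmul x y (@hahn_well_ordered x)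
    (@hahn_well_ordered y)).

Lemma hmul_monomial v c x q : hmul (monomial v c) x q = c * x (q - v).
Proof.
rewrite (@hmul_seq _ _ _ [:: v]) // ?big_seq1 /= ?eqxx // => i.
by rewrite inE; case: (i == v) => //; rewrite eqxx.
Qed.

Fact hahn_mulA : associative hahn_mul.
Proof. by move=> x y z; apply: hahnP => q /=; rewrite hmulA //; exact: hahn_well_ordered. Qed.
Fact hahn_mulC : commutative hahn_mul.
Proof. by move=> x y; apply: hahnP => q /=; rewrite hmulC //; exact: hahn_well_ordered. Qed.
Fact hahn_mul1 : left_id (monomial 0 1) hahn_mul.
Proof. by move=> x; apply: hahnP => q /=; rewrite hmul_monomial mul1r subr0. Qed.
Fact hahn_mulD : left_distributive hahn_mul hahn_add.
Proof. by move=> x y z; apply: hahnP => q /=; rewrite hmulDl //; exact: hahn_well_ordered. Qed.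
Fact hahn_1neq0 : monomial 0 1 != 0 :> hahn.
Proof.
apply/eqP => /(congr1 (fun x : hahn => x 0)) /= /eqP.
by rewrite oner_eq0.
Qed.
HB.instance Definition _ := GRing.Zmodule_isComNzRing.Build hahn
  hahn_mulA hahn_mulC hahn_mul1 hahn_mulD hahn_1neq0.

Lemma hahnDE (x y : hahn) q : (x + y) q = x q + y q. Proof. by []. Qed.
Lemma hahnNE (x : hahn) q : (- x) q = - x q. Proof. by []. Qed.
Lemma hahn0E q : (0 : hahn) q = 0. Proof. by []. Qed.
Lemma hahnBE (x y : hahn) q : (x - y) q = x q - y q. Proof. by []. Qed.
Lemma hahn1E q : (1 : hahn) q = (q == 0)%:R.
Proof. by rewrite /=; case: eqP. Qed.
Lemma hahnME (x y : hahn) : (x * y : hahn) = hmul x y :> (rat -> K).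
Proof. by []. Qed.
Lemma hahn_sumE I (r : seq I) (P : pred I) (F : I -> hahn) q :
  (\sum_(i <- r | P i) F i) q = \sum_(i <- r | P i) F i q.
Proof. by apply: (big_morph (fun x : hahn => x q)). Qed.
Lemma hahnXE (x : hahn) n : (x ^+ n : hahn) = hexp x n :> (rat -> K).
Proof.
elim: n => [|n IH]; first by apply/funext => q; rewrite expr0 hahn1E.
by rewrite exprS hahnME IH.
Qed.

Lemma monomialM v c (x : hahn) q : (monomial v c * x) q = c * x (q - v).
Proof. exact: hmul_monomial. Qed.
Lemma monomialMM v w c d : monomial v c * monomial w d = monomial (v + w) (c * d).
Proof.
apply: hahnP => q; rewrite monomialM /= subr_eq [v + w]addrC.
by case: eqP; rewrite ?mulr0.
Qed.
Lemma monomial01 : monomial 0 1 = 1. Proof. by []. Qed.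
Lemma hahn_neq0P (x : hahn) : x <> 0 -> exists q, x q != 0.
Proof.
move=> nz; apply: contrapT => no; apply: nz; apply: hahnP => q.
by apply/eqP/negPn/negP => xq; apply: no; exists q.
Qed.
Lemma hahn_mul_neq0 (x y : hahn) k : (x * y) k != 0 ->
  exists i j, [/\ x i != 0, y j != 0 & k = i + j].
Proof. exact: hmul_neq0. Qed.

End HahnRing.

(** * Frobenius and Puiseux series *)

(** Recursion on all earlier values: an equation whose right side only involves earlier coefficients
    can be solved while being written with a total function. It yields inverses of power series and
    roots of additive equations. *)
Lemma course_of_values (T : Type) (d : T) (Phi : nat -> (nat -> T) -> T) :
  exists u : nat -> T,
    forall k, u k = Phi k (fun l => if (l < k)%N then u l else d).
Proof.
pose s := fix s k := if k is k'.+1 then rcons (s k') (Phi k' (nth d (s k'))) else [::].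
have size_s k : size (s k) = k by elim: k => //= k IH; rewrite size_rcons IH.
have nth_s k l : (l < k)%N -> nth d (s k) l = nth d (s l.+1) l.
  elim: k => // k IH; rewrite ltnS leq_eqVlt => /predU1P [-> //|lk].
  by rewrite [s k.+1]/= nth_rcons size_s lk IH.
exists (fun k => nth d (s k.+1) k) => k.
rewrite [s k.+1]/= nth_rcons size_s ltnn eqxx; congr (Phi k _).
apply/funext => l; case: ltnP => lk; first exact: nth_s.
by rewrite nth_default // size_s.
Qed.

Section Puiseux.
Variable K : closedFieldType.
Local Notation H := (hahn K).

Section Frobenius.
Variable p : nat.
Hypothesis charp : p \in [pchar K].
Let p_gt0 : (0 < p)%N. Proof. exact/prime_gt0/(pcharf_prime charp). Qed.
Let p_prime : prime p. Proof. exact: (pcharf_prime charp). Qed.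
Let pQ : (p%:R : rat) != 0. Proof. by rewrite pnatr_eq0 -lt0n. Qed.

Lemma hahn_natE n q : (n%:R : H) q = if q == 0 then n%:R else 0.
Proof.
elim: n => [|n IH]; first by case: ifP.
by rewrite -addn1 !natrD hahnDE IH hahn1E; case: eqP => //; rewrite addr0.
Qed.

Lemma hahn_pchar : p \in [pchar H].
Proof.
rewrite !inE p_prime; apply/eqP/hahnP => q; rewrite hahn_natE pcharf0 //.
by case: eqP.
Qed.

Lemma hahn_supp_lt (x : H) u n k : (forall q, x q != 0 -> q < u) ->
  (0 < n)%N -> (x ^+ n) k != 0 -> k < u *+ n.
Proof.
move=> xu; elim: n k => // -[|n] IH k _; first by rewrite expr1; exact: xu.
rewrite exprS mulrS => /hahn_mul_neq0 [i [j [xi xj ->]]].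
by apply: ltrD; [exact: xu | exact: IH].
Qed.

Lemma hahn_supp_gt (x : H) u n k : (forall q, x q != 0 -> u < q) ->
  (0 < n)%N -> (x ^+ n) k != 0 -> u *+ n < k.
Proof.
move=> xu; elim: n k => // -[|n] IH k _; first by rewrite expr1; exact: xu.
rewrite exprS mulrS => /hahn_mul_neq0 [i [j [xi xj ->]]].
by apply: ltrD; [exact: xu | exact: IH].
Qed.

Fact well_ordered_restrict (P : pred rat) (x : H) : well_ordered (hsupp (fun q =>
    if P q then x q else 0)).
Proof.
apply: well_ordered_sub (@hahn_well_ordered _ x) => q; rewrite /hsupp /=.
by case: (P q) => //; rewrite eqxx.
Qed.
Definition restrict P x : H := mkhahn (@well_ordered_restrict P x).

Lemma monomial_exp v (c : K) n : monomial v c ^+ n = monomial (v *+ n) (c ^+ n).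
Proof.
by elim: n => [|n IH]; rewrite ?expr0 // !exprS IH monomialMM mulrS.
Qed.

(* Split [x] at [q/p]: p-fold sums of exponents below (above) [q/p] are below (above) [q],
   so only the monomial of exponent [q/p] contributes to the coefficient at [q]. *)
Lemma hahn_frobE (x : H) q : (x ^+ p) q = (x (q / p%:R)) ^+ p.
Proof.
set u := q / p%:R; have Eq : q = u *+ p by rewrite -mulr_natr divfK.
pose xl := restrict (fun q => q < u) x; pose xg := restrict (fun q => u < q) x.
have Ex : x = xl + (xg + monomial u (x u)).
  by apply: hahnP => r; rewrite !hahnDE /=; case: ltgtP => [||->] /=;
     rewrite ?addr0 ?add0r.
rewrite {1}Ex -(pFrobenius_autE hahn_pchar) !rmorphD /= !pFrobenius_autE monomial_exp.
have xlu r : xl r != 0 -> r < u by rewrite /=; case: ifP => //; rewrite eqxx.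
have -> : (xl ^+ p) q = 0.
  by apply/eqP/negPn/negP => /(hahn_supp_lt xlu p_gt0); rewrite -Eq ltxx.
have xgu r : xg r != 0 -> u < r by rewrite /=; case: ifP => //; rewrite eqxx.
have -> : (xg ^+ p) q = 0.
  by apply/eqP/negPn/negP => /(hahn_supp_gt xgu p_gt0); rewrite -Eq ltxx.
by rewrite /= -Eq eqxx !add0r.
Qed.

Lemma hahn_frob_inj : injective (fun x : H => x ^+ p).
Proof.
move=> x y /= E; apply: hahnP => q; apply: (fmorph_inj (pFrobenius_aut charp)).
have := congr1 (fun x : H => x (q * p%:R)) E.
by rewrite !hahn_frobE mulfK // !pFrobenius_autE.
Qed.

End Frobenius.

(** For [a > 0] this is the subfield K((t^(1/a))). *)
Definition laurent_at (a : nat) (x : H) : Prop :=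
  exists N : int, forall q, x q != 0 -> exists n : int, N <= n /\ q = n%:~R / a%:R.

Lemma laurent_at_scale a b x : (0 < b)%N -> laurent_at a x -> laurent_at (a * b) x.
Proof.
move=> b0 [N NP]; exists (N * b) => q /NP [n [Nn ->]]; exists (n * b); split.
  by rewrite ler_wpM2r.
by rewrite intrM natrM -mulf_div divff ?mulr1 // pnatr_eq0 -lt0n.
Qed.

Lemma laurent_atD a x y : laurent_at a x -> laurent_at a y -> laurent_at a (x + y).
Proof.
move=> [N NP] [M MP]; exists (Order.min N M) => q; rewrite hahnDE.
have [->|/NP [n [Nn ->]] _] := eqVneq (x q) 0.
  by rewrite add0r => /MP [n [Nn ->]]; exists n; rewrite ge_min Nn orbT.
by exists n; rewrite ge_min Nn.
Qed.

Lemma laurent_atN a x : laurent_at a x -> laurent_at a (- x).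
Proof. by move=> [N NP]; exists N => q; rewrite hahnNE oppr_eq0; exact: NP. Qed.

Lemma laurent_atM a x y : laurent_at a x -> laurent_at a y -> laurent_at a (x * y).
Proof.
move=> [N NP] [M MP]; exists (N + M) => q /hahn_mul_neq0 [i [j [xi xj ->]]].
have [n [Nn ->]] := NP _ xi; have [m [Mm ->]] := MP _ xj.
by exists (n + m); rewrite lerD // -mulrDl intrD.
Qed.

Lemma laurent_at_monomial a (n : int) c : laurent_at a (monomial (n%:~R / a%:R) c).
Proof.
exists n => q /=; have [->|_] := eqVneq q; last by rewrite eqxx.
by exists n.
Qed.

Lemma laurent_at1 a : laurent_at a 1.
Proof. by rewrite -monomial01; have := laurent_at_monomial a 0 1; rewrite mul0r. Qed.

(* [ps a f] is the series [\sum_n f n * t^(n/a)]. *)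
Definition ps_fun (a : nat) (f : nat -> K) (q : rat) : K :=
  if (0 <= q) && (denq (q * a%:R) == 1) then f `|numq (q * a%:R)|%N else 0.

Lemma ps_funE a f n : (0 < a)%N -> ps_fun a f (n%:R / a%:R) = f n.
Proof.
move=> a0; rewrite /ps_fun divr_ge0 ?ler0n // divfK ?pnatr_eq0 -?lt0n //.
by rewrite -[n%:R]/(n%:~R) denq_int numq_int eqxx /=.
Qed.

Lemma ps_fun_neq0 a f q : (0 < a)%N -> ps_fun a f q != 0 ->
  exists2 n, q = n%:R / a%:R & f n != 0.
Proof.
move=> a0; have aQ : (a%:R : rat) != 0 by rewrite pnatr_eq0 -lt0n.
rewrite /ps_fun; case: andP => [[q0 /eqP dq] fn|_]; last by rewrite eqxx.
exists `|numq (q * a%:R)|%N => //.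
apply: (mulIf aQ); rewrite divfK // natr_absz ger0_norm.
  by rewrite -[LHS]divq_num_den dq divr1.
by rewrite numq_ge0 mulr_ge0.
Qed.

Fact well_ordered_ps a f : (0 < a)%N -> well_ordered (hsupp (ps_fun a f)).
Proof.
move=> a0 B sB [b Bb].
have ex : exists n : nat, `[< B (n%:R / a%:R) >].
  by have [n En _] := ps_fun_neq0 a0 (sB _ Bb); exists n; apply/asboolP; rewrite -En.
case: (ex_minnP ex) => m /asboolP Bm minm; exists (m%:R / a%:R) => // c Bc.
have [n En _] := ps_fun_neq0 a0 (sB _ Bc).
rewrite En ler_pM2r ?invr_gt0 ?ltr0n // ler_nat minm //.
by apply/asboolP; rewrite -En.
Qed.
(** The default 0 at [a = 0] spares [ps] a proof argument. *)
Definition ps a f : H :=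
  if pselect (0 < a)%N is left a0 then mkhahn (@well_ordered_ps a f a0) else 0.

Section Fixed.
Variable a : nat.
Hypothesis a0 : (0 < a)%N.
Let aQ : (a%:R : rat) != 0. Proof. by rewrite pnatr_eq0 -lt0n. Qed.

Lemma psE f n : ps a f (n%:R / a%:R) = f n.
Proof. by rewrite /ps; case: pselect => // h /=; rewrite ps_funE. Qed.

Lemma ps_neq0 f q : ps a f q != 0 -> exists2 n, q = n%:R / a%:R & f n != 0.
Proof. by rewrite /ps; case: pselect => // h /=; exact: ps_fun_neq0. Qed.

Lemma laurent_at_ps f : laurent_at a (ps a f).
Proof. by exists 0 => q /ps_neq0 [n -> _]; exists n%:Z. Qed.

Lemma ps_ext f (x : H) : (forall n, x (n%:R / a%:R) = f n) ->
  (forall q, x q != 0 -> exists n, q = n%:R / a%:R) -> x = ps a f.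
Proof.
move=> xf xs; apply: hahnP => q.
have [[n ->]|no] := pselect (exists n, q = n%:R / a%:R); first by rewrite xf psE.
transitivity (0 : K); [|apply/esym]; apply/eqP/negPn/negP.
  by move/xs.
by move/ps_neq0 => [n En _]; apply: no; exists n.
Qed.

Lemma psM f g : ps a f * ps a g = ps a (fun n => \sum_(i < n.+1) f i * g (n - i)%N).
Proof.
apply: ps_ext => [n|q /hahn_mul_neq0 [i [j [/ps_neq0 [n -> _] /ps_neq0 [m -> _] ->]]]];
  last by exists (n + m)%N; rewrite natrD mulrDl.
have inj : injective (fun i : nat => i%:R / a%:R : rat).
  by move=> i j /(mulIf (invr_neq0 aQ)) /eqP; rewrite eqr_nat => /eqP.
rewrite hahnME (@hmul_seq _ _ _ _ [seq i%:R / a%:R | i <- iota 0 n.+1]).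
- rewrite big_map -[iota _ _]/(index_iota 0 n.+1) big_mkord; apply: eq_bigr => i _.
  by rewrite psE -mulrBl -natrB ?psE // -ltnS.
- by rewrite map_inj_uniq ?iota_uniq.
move=> i /ps_neq0 [j -> _] /ps_neq0 [m /eqP E _]; apply/mapP; exists j => //.
rewrite mem_iota /= add0n ltnS; move: E; rewrite -mulrBl.
rewrite (inj_eq (mulIf (invr_neq0 aQ))) subr_eq -natrD eqr_nat => /eqP ->.
by rewrite leq_addl.
Qed.

Lemma psD f g : ps a f + ps a g = ps a (fun n => f n + g n).
Proof.
apply: ps_ext => [n|q]; first by rewrite hahnDE !psE.
rewrite hahnDE; have [->|/ps_neq0 [n -> _] _] := eqVneq (ps a f q) 0; last by exists n.
by rewrite add0r => /ps_neq0 [n -> _]; exists n.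
Qed.

Lemma ps0 : ps a (fun=> 0) = 0.
Proof. by apply/esym/ps_ext => // q; rewrite eqxx. Qed.

Lemma ps1 : ps a (fun n => (n == 0)%:R) = 1.
Proof.
apply/esym/ps_ext => [n|q].
  by rewrite hahn1E mulf_eq0 invr_eq0 (negPf aQ) orbF pnatr_eq0.
rewrite hahn1E; have [->|_] := eqVneq q 0; last by rewrite eqxx.
by exists 0%N; rewrite mul0r.
Qed.

Lemma ps_sum (I : Type) (r : seq I) (P : pred I) (F : I -> nat -> K) :
  \sum_(i <- r | P i) ps a (F i) = ps a (fun n => \sum_(i <- r | P i) F i n).
Proof.
elim: r => [|i r IH]; first by rewrite big_nil -ps0; congr ps; apply/funext => n; rewrite big_nil.
rewrite big_cons IH; case: ifP => Pi; last first.
  by congr ps; apply/funext => n; rewrite big_cons Pi.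
by rewrite psD; congr ps; apply/funext => n; rewrite big_cons Pi.
Qed.

End Fixed.
End Puiseux.

(** * The field of Puiseux series *)

Section PuiseuxField.
Variable K : closedFieldType.
Local Notation H := (hahn K).

(** The well-ordered support has a least exponent [m / a], and [g] lists the coefficients from there
    on. *)
Lemma laurent_at_lead a (x : H) : (0 < a)%N -> laurent_at a x -> x != 0 ->
  exists (m : int) g, g 0 != 0 /\ x = monomial (m%:~R / a%:R) 1 * ps a g.
Proof.
move=> a0 lx /eqP /hahn_neq0P [q0 xq0].
have [q xq qmin] := @hahn_well_ordered _ x (hsupp x) (fun _ h => h) (ex_intro _ q0 xq0).
have [N NP] := lx; have [m [_ Em]] := NP _ xq.
have lx' : forall q, x q != 0 -> exists n : int, m <= n /\ q = n%:~R / a%:R.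
  move=> r xr; have [n [_ En]] := NP _ xr; exists n; split=> //.
  have := qmin _ xr; rewrite En Em ler_pM2r ?ler_int //.
  by rewrite invr_gt0 ltr0n.
exists m, (fun n => x ((m + n%:Z)%:~R / a%:R)); split; first by rewrite addr0 -Em.
apply: hahnP => r; rewrite monomialM mul1r; apply/esym.
have [[n ->]|no] := pselect (exists n : nat, r = (m + n%:Z)%:~R / a%:R).
  have -> : (m + n%:Z)%:~R / a%:R - m%:~R / a%:R = n%:R / a%:R :> rat.
    by rewrite -mulrBl rmorphD /= addrAC subrr add0r.
  by rewrite psE.
transitivity (0 : K); [|apply/esym]; apply/eqP/negPn/negP.
  move/(ps_neq0 a0) => [n En _]; apply: no; exists n.
  by rewrite rmorphD /= mulrDl -[n%:~R]/(n%:R) -En addrC subrK.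
move/lx' => [n [Nn En]]; apply: no; exists `|n - m|%N.
rewrite gez0_abs ?subr_ge0 // En; congr (_%:~R / _).
by rewrite addrCA subrr addr0.
Qed.

(** Comparing coefficients in the product determines [h] recursively. The value of [h 0] is recorded
    for [additive_root], which needs a constant term there. *)
Lemma ps_inv a (g : nat -> K) : (0 < a)%N -> g 0 != 0 ->
  exists h, h 0 = (g 0)^-1 /\ ps a g * ps a h = 1.
Proof.
move=> a0 g0.
have [h hE] := @course_of_values K 0 (fun k h =>
  (g 0)^-1 * ((k == 0)%:R - \sum_(i < k) g i.+1 * h (k - i.+1)%N)).
exists h; split; first by rewrite hE eqxx big_ord0 subr0 mulr1.
rewrite psM // -(ps1 _ a0); congr ps; apply/funext => n.
rewrite big_ord_recl subn0 [h n]hE mulrA divff // mul1r.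
rewrite -[RHS](subrK (\sum_(i < n) g i.+1 * h (n - i.+1)%N)).
congr (_ - _ + _); apply: eq_bigr => i _.
by rewrite ifT // ltn_subrL /= (leq_ltn_trans _ (ltn_ord i)).
Qed.

Lemma laurent_at_inv a (x : H) : (0 < a)%N -> laurent_at a x -> x != 0 ->
  exists2 y, laurent_at a y & x * y = 1.
Proof.
move=> a0 lx x0; have [m [g [g0 ->]]] := laurent_at_lead a0 lx x0.
have [h [_ hP]] := ps_inv a0 g0.
exists (monomial ((- m)%:~R / a%:R) 1 * ps a h).
  by apply: laurent_atM; [exact: laurent_at_monomial | exact: laurent_at_ps].
rewrite mulrACA hP mulr1 monomialMM mulr1 -mulrDl -intrD subrr mul0r; exact: monomial01.
Qed.

Definition is_puiseux (x : H) : Prop := exists a : nat, (0 < a)%N /\ laurent_at a x.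
Definition puis_pred : {pred H} := fun x => `[< is_puiseux x >].

Lemma puis_common (x y : H) : is_puiseux x -> is_puiseux y ->
  exists a : nat, [/\ (0 < a)%N, laurent_at a x & laurent_at a y].
Proof.
move=> [a [a0 la]] [b [b0 lb]]; exists (a * b)%N; split.
- by rewrite muln_gt0 a0.
- exact: laurent_at_scale.
- by rewrite mulnC; exact: laurent_at_scale.
Qed.

Fact puis_subring : subring_closed puis_pred.
Proof.
split; first by apply/asboolP; exists 1%N; split=> //; exact: laurent_at1.
- move=> x y /asboolP px /asboolP py; apply/asboolP.
  have [a [a0 lx ly]] := puis_common px py.
  by exists a; split=> //; apply: laurent_atD => //; exact: laurent_atN.
- move=> x y /asboolP px /asboolP py; apply/asboolP.
  have [a [a0 lx ly]] := puis_common px py.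
  by exists a; split=> //; exact: laurent_atM.
Qed.
HB.instance Definition _ := GRing.isSubringClosed.Build H puis_pred puis_subring.

Record puiseux := Puiseux { puis_val :> H; _ : puis_val \in puis_pred }.
HB.instance Definition _ := [isSub for puis_val].
HB.instance Definition _ := [Choice of puiseux by <:].
HB.instance Definition _ := [SubChoice_isSubComNzRing of puiseux by <:].

Lemma puisP (x : puiseux) : is_puiseux x.
Proof. by case: x => x /= /asboolP. Qed.

Definition mkpuis (x : H) (px : is_puiseux x) : puiseux := Puiseux (introT (asboolP _) px).

Fact puis_inv_ex (x : puiseux) :
  exists y : puiseux, (x != 0 -> y * x = 1) /\ (x = 0 -> y = 0).
Proof.
have [->|x0] := eqVneq x 0; first by exists 0.
have [a [a0 la]] := puisP x.
have [y ly xy] := laurent_at_inv a0 la x0.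
exists (@mkpuis y (ex_intro _ a (conj a0 ly))); split=> [_|/eqP]; last first.
  by rewrite (negPf x0).
by apply: val_inj; rewrite rmorphM rmorph1 /= mulrC.
Qed.
Definition puis_inv (x : puiseux) : puiseux := projT1 (cid (puis_inv_ex x)).
Fact puis_mulVf x : x != 0 -> puis_inv x * x = 1.
Proof. by rewrite /puis_inv; case: cid => y [] /=. Qed.
Fact puis_invr0 : puis_inv 0 = 0.
Proof. by rewrite /puis_inv; case: cid => y [_ /= ->]. Qed.
HB.instance Definition _ := GRing.ComNzRing_isField.Build puiseux puis_mulVf puis_invr0.

Definition puiseux_hahn : {rmorphism puiseux -> H} := val.

Lemma puis_common_fam n (A : nat -> puiseux) :
  exists a : nat, (0 < a)%N /\ forall i, (i < n)%N -> laurent_at a (A i).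
Proof.
elim: n => [|n [a [a0 aP]]]; first by exists 1%N.
have [b [b0 bP]] := puisP (A n); exists (a * b)%N; split; first by rewrite muln_gt0 a0.
move=> i; rewrite ltnS leq_eqVlt => /predU1P [->|/aP]; last exact: laurent_at_scale.
by rewrite mulnC; exact: laurent_at_scale.
Qed.

(** * Puiseux roots of additive polynomials *)

Section Additive.
Variable p : nat.
Hypothesis charp : p \in [pchar K].
Let p_gt1 : (1 < p)%N. Proof. exact/prime_gt1/(pcharf_prime charp). Qed.
Let p_gt0 : (0 < p)%N. Proof. exact/ltnW. Qed.
Let pn0 i : (0 < p ^ i)%N. Proof. by rewrite expn_gt0 p_gt0. Qed.

Lemma hahn_frob_iterE (x : H) i q :
  (x ^+ (p ^ i)) q = (x (q / (p ^ i)%:R)) ^+ (p ^ i).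
Proof.
elim: i q => [|i IH] q; first by rewrite expn0 !expr1 divr1.
rewrite expnSr exprM (hahn_frobE charp) IH -!exprM; congr (x _ ^+ _).
by rewrite natrM invfM; ring.
Qed.

Definition frob_coef (f : nat -> K) i n : K :=
  if (p ^ i %| n)%N then f (n %/ p ^ i)%N ^+ (p ^ i) else 0.

Lemma ps_frob a f i : (0 < a)%N -> ps a f ^+ (p ^ i) = ps a (frob_coef f i).
Proof.
move=> a0; have aQ : (a%:R : rat) != 0 by rewrite pnatr_eq0 -lt0n.
have pQ : ((p ^ i)%:R : rat) != 0 by rewrite pnatr_eq0 -lt0n.
apply: ps_ext => // [n|q].
  rewrite hahn_frob_iterE /frob_coef; case: ifP => [/dvdnP [m ->]|nd].
    by rewrite mulnK // natrM [_ / a%:R / _]mulrAC mulfK // psE.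
  apply/eqP; rewrite expf_eq0 pn0 /=; apply/negPn/negP => /(ps_neq0 a0) [m E _].
  move: nd; suff -> : n = (m * p ^ i)%N by rewrite dvdn_mull.
  apply/eqP; rewrite -(eqr_nat rat) natrM.
  by apply/eqP; apply: (mulIf (invr_neq0 aQ)); rewrite mulrAC -E divfK.
rewrite hahn_frob_iterE expf_eq0 pn0 /= => /(ps_neq0 a0) [m E _].
by exists (m * p ^ i)%N; rewrite natrM mulrAC -E divfK.
Qed.

(* The coefficient of [t^(n/a)] in [u^(p^i)], i > 0, involves only coefficients
   of [u] of index < n, so the equation is solved recursively from [rho]. *)
Lemma ps_additive_root a r (c : nat -> nat -> K) (rho : K) : (0 < a)%N ->
  rho + \sum_(i < r) c i 0%N * rho ^+ (p ^ i.+1) = 0 ->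
  exists u, u 0%N = rho /\
    ps a u + \sum_(i < r) ps a (c i) * ps a u ^+ (p ^ i.+1) = 0.
Proof.
move=> a0 rhoP.
pose S n (u : nat -> K) :=
  \sum_(i < r) \sum_(l < n.+1) c i l * frob_coef u i.+1 (n - l)%N.
have [u uE] := @course_of_values K 0 (fun n u => if n is 0 then rho else - S n u).
exists u; split; first by rewrite uE.
transitivity (ps a (fun n => u n + S n u)).
  rewrite -psD //; congr (_ + _); rewrite -ps_sum //; apply: eq_bigr => i _.
  by rewrite ps_frob // psM.
rewrite -(ps0 _ a0); congr ps; apply/funext => n; rewrite uE.
case: n => [|n].
  rewrite -rhoP; congr (_ + _); apply: eq_bigr => i _.
  by rewrite big_ord_recl big_ord0 addr0 /frob_coef dvdn0 div0n uE.
rewrite addrC; apply/eqP; rewrite subr_eq0; apply/eqP.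
apply: eq_bigr => i _; apply: eq_bigr => l _; congr (_ * _).
rewrite /frob_coef; case: ifP => // dv; rewrite ifT //.
have [->|nz] := posnP (n.+1 - l)%N; first by rewrite div0n.
apply: leq_trans (leq_subr l _); apply: ltn_Pdiv => //.
by rewrite -[1%N](exp1n i.+1) ltn_exp2r.
Qed.

(** Dividing by [rho] leaves the polynomial [P]: the hypothesis on [c i1] makes it nonconstant, and
    its constant term 1 keeps its roots away from 0. *)
Lemma residual_root r (c : nat -> K) i1 : (i1 < r)%N -> c i1 != 0 ->
  exists2 rho : K, rho != 0 & rho + \sum_(i < r) c i * rho ^+ (p ^ i.+1) = 0.
Proof.
move=> i1r ci1.
pose P : {poly K} := 1 + \sum_(i < r) c i *: 'X^(p ^ i.+1 - 1).
have pos i : (0 < p ^ i.+1 - 1)%N.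
  by rewrite subn_gt0 -[1%N](exp1n i.+1) ltn_exp2r.
have : size P != 1%N.
  apply/eqP => s1; have : P`_(p ^ i1.+1 - 1) = 0 by rewrite nth_default // s1.
  rewrite coefD coef1 coef_sum (bigD1 (Ordinal i1r)) //= coefZ coefXn eqxx mulr1.
  rewrite (gtn_eqF (pos _)) add0r big1 ?addr0; first by move/eqP; rewrite (negPf ci1).
  move=> i ne; rewrite coefZ coefXn; case: eqP => [E|]; last by rewrite mulr0.
  case/eqP: ne; apply: val_inj => /=; apply/eqP; rewrite -eqSS -(eqn_exp2l _ _ p_gt1).
  by rewrite -(subnK (pn0 i.+1)) -(subnK (pn0 i1.+1)) E.
case/closed_rootP => rho /rootP Pr; exists rho.
  apply/eqP => r0; move: Pr; rewrite r0 hornerD hornerC horner_sum big1 ?addr0.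
    by move/eqP; rewrite oner_eq0.
  by move=> i _; rewrite hornerZ hornerXn expr0n (gtn_eqF (pos _)) mulr0.
have -> : rho + \sum_(i < r) c i * rho ^+ (p ^ i.+1) = rho * P.[rho].
  rewrite hornerD hornerC mulrDr mulr1 horner_sum mulr_sumr; congr (_ + _).
  apply: eq_bigr => i _; rewrite hornerZ hornerXn mulrCA -exprS.
  by rewrite subn1 prednK.
by rewrite Pr mulr0.
Qed.

(* [v] is the first slope of the Newton polygon; after the substitution [y = t^v u] the
   coefficient of [u] is a unit, so the reduced equation is separable. *)
Lemma additive_root r (A : nat -> puiseux) i0 :
  A 0%N != 0 -> (i0 < r)%N -> A i0.+1 != 0 ->
  exists2 y : puiseux, y != 0 & \sum_(i < r.+1) A i * y ^+ (p ^ i) = 0.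
Proof.
move=> A0 i0r Ai0.
have [a [a0 laA]] := puis_common_fam r.+1 A.
have [m0 [g0 [g00 EA0]]] := laurent_at_lead a0 (laA 0%N isT) A0.
have [h [h0 gh]] := ps_inv a0 g00.
have lead i : exists mg : int * (nat -> K), (i < r)%N -> A i.+1 != 0 ->
    mg.2 0%N != 0 /\ A i.+1 = monomial (mg.1%:~R / a%:R) 1 * ps a mg.2 :> H.
  have [ir|] := boolP (i < r)%N; last by exists (0, fun=> 0).
  have [Ai|Ai] := eqVneq (A i.+1) 0; first by exists (0, fun=> 0).
  have [m [g [g1 E]]] := laurent_at_lead a0 (laA i.+1 ir) Ai.
  by exists (m, g).
pose m i := (projT1 (cid (lead i))).1; pose g i := (projT1 (cid (lead i))).2.
have mgP i : (i < r)%N -> A i.+1 != 0 ->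
    g i 0%N != 0 /\ A i.+1 = monomial ((m i)%:~R / a%:R) 1 * ps a (g i) :> H.
  by rewrite /m /g; case: cid.
have p1 i : (0 : rat) < (p ^ i.+1 - 1)%:R.
  by rewrite ltr0n subn_gt0 -[1%N](exp1n i.+1) ltn_exp2r.
(* If y has order [s i], then A_0 y and A_(i+1) y^(p^(i+1)) have the same order. At the largest of
   these values no term has smaller order than the linear one. *)
pose s (i : 'I_r) : rat := (m0%:~R - (m i)%:~R) / a%:R / (p ^ i.+1 - 1)%:R.
pose i0' := Ordinal i0r.
have [i1 Ai1 maxi1] := @arg_maxP _ _ _ i0' (fun i : 'I_r => A i.+1 != 0) s Ai0.
(* A denominator for which [v] is an exponent. *)
pose a' := (a * (p ^ i1.+1 - 1))%N.
have q0 : (0 < p ^ i1.+1 - 1)%N by rewrite -(ltr0n rat).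
have a'0 : (0 < a')%N by rewrite muln_gt0 a0.
pose v := s i1.
have vE : v = (m0 - m i1)%:~R / a'%:R.
  by rewrite /v /s -mulrA -invfM -natrM rmorphB.
have lauv n : laurent_at a' (monomial (v *+ n) (1 : K)).
  by rewrite vE -mulrnAl -rmorphMn; exact: laurent_at_monomial.
have laumono n : laurent_at a' (monomial (n%:~R / a%:R) (1 : K)).
  by apply: laurent_at_scale => //; exact: laurent_at_monomial.
pose B0 : H := monomial (- (m0%:~R / a%:R)) 1 * ps a h.
have AB : puiseux_hahn (A 0%N) * B0 = 1.
  by rewrite /= EA0 /B0 mulrACA gh mulr1 monomialMM mulr1 subrr.
(* The coefficients of the equation for u after y = t^v u and division by A_0 t^v. By the choice of
   [v] they have no negative exponents, and [C i1] has a nonzero constant term. *)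
pose C (i : nat) : H := B0 * monomial (- v) 1 * puiseux_hahn (A i.+1) *
    monomial (v *+ (p ^ i.+1)) 1.
have CE i : (i < r)%N -> A i.+1 != 0 ->
    C i = monomial ((m i)%:~R / a%:R - m0%:~R / a%:R + v *+ (p ^ i.+1 - 1)) 1
          * (ps a (g i) * ps a h).
  move=> ir Ai; rewrite /C /B0 /= (mgP i ir Ai).2.
  have -> : monomial ((m i)%:~R / a%:R - m0%:~R / a%:R + v *+ (p ^ i.+1 - 1)) 1 =
     monomial (- (m0%:~R / a%:R)) 1 * monomial (- v) 1 * monomial ((m i)%:~R / a%:R) 1 *
         monomial (v *+ (p ^ i.+1)) 1 :> H.
    rewrite !monomialMM !mulr1; congr monomial.
    by rewrite mulrnBr // mulr1n; ring.
  ring.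
have e0 i : (i < r)%N -> A i.+1 != 0 ->
    0 <= (m i)%:~R / a%:R - m0%:~R / a%:R + v *+ (p ^ i.+1 - 1).
  move=> ir Ai; have := maxi1 (Ordinal ir) Ai; rewrite /= -/v {1}/s /=.
  by rewrite ler_pdivrMr ?p1 // mulr_natr mulrBl; lra.
have gh_supp i q : (ps a (g i) * ps a h) q != 0 -> exists n, q = n%:R / a'%:R.
  rewrite psM // => /(ps_neq0 a0) [n -> _]; exists (n * (p ^ i1.+1 - 1))%N.
  by rewrite natrM natrM -mulf_div divff ?mulr1 // pnatr_eq0 -lt0n.
have lauC i : (i < r)%N -> laurent_at a' (C i).
  move=> ir; rewrite /C; apply: laurent_atM; last exact: lauv.
  apply: laurent_atM; last by apply: laurent_at_scale => //; exact: laA.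
  apply: laurent_atM; last first.
    by rewrite vE -mulNr -rmorphN; exact: laurent_at_monomial.
  rewrite /B0; apply: laurent_atM; last by apply: laurent_at_scale => //; exact: laurent_at_ps.
  by rewrite -mulNr -rmorphN; exact: laumono.
pose c (i n : nat) : K := C i (n%:R / a'%:R).
have a'Q : (0 : rat) < a'%:R^-1 by rewrite invr_gt0 ltr0n.
have Cps i : (i < r)%N -> C i = ps a' (c i).
  move=> ir; apply: ps_ext => // q Cq.
  have [N NP] := lauC i ir; have [n [_ En]] := NP _ Cq.
  have Ai : A i.+1 != 0.
    apply/eqP => Az; move: Cq.
    by rewrite /C Az rmorph0 mulr0 mul0r hahn0E eqxx.
  suff n0 : 0 <= n by exists `|n|%N; rewrite natr_absz ger0_norm.
  move: Cq; rewrite CE // monomialM mul1r => /(gh_supp i) [k Ek].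
  have : 0 <= q.
    have k0 : (0 : rat) <= k%:R / a'%:R by rewrite mulr_ge0 ?ler0n // ltW.
    by have := e0 i ir Ai; lra.
  by rewrite En pmulr_lge0 // ler0z.
have ci1 : c i1 0%N != 0.
  rewrite /c CE // monomialM mul0r mul1r.
  have -> : 0 - ((m i1)%:~R / a%:R - m0%:~R / a%:R + v *+ (p ^ i1.+1 - 1)) = 0%:R / a%:R :> rat.
    rewrite -[v *+ _]mulr_natr /v /s divfK; last by rewrite gt_eqF.
    by rewrite mulrBl mul0r; lra.
  rewrite psM // psE // big_ord_recl big_ord0 addr0 subnn h0 mulf_neq0 //.
    by have [] := mgP i1 (ltn_ord i1) Ai1.
  by rewrite invr_eq0.
have [rho rho0 rhoP] := @residual_root r (fun i => c i 0%N) i1 (ltn_ord i1) ci1.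
have [u [u0 uP]] := ps_additive_root a'0 rhoP.
pose y : H := monomial v 1 * ps a' u.
have ly : laurent_at a' y.
  by apply: laurent_atM; [have := lauv 1%N; rewrite mulr1n | exact: laurent_at_ps].
exists (@mkpuis y (ex_intro _ a' (conj a'0 ly))).
  apply/eqP => /(congr1 (fun x : puiseux => (x : H) v)) /=.
  have -> : hmul (monomial v 1) (ps a' u) v = y v by [].
  rewrite /y monomialM mul1r subrr -(mul0r a'%:R^-1) -[0]/(0%:R) psE // u0.
  by move/eqP; rewrite (negPf rho0).
apply: val_inj; rewrite -[LHS]/(puiseux_hahn _) rmorph_sum rmorph0.
rewrite big_ord_recl rmorphM rmorphXn expn0 expr1.
transitivity (puiseux_hahn (A 0%N) * monomial v 1 * (ps a' u +
    \sum_(i < r) ps a' (c i) * ps a' u ^+ (p ^ i.+1))).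
  rewrite mulrDr mulrA mulr_sumr; congr (_ + _); apply: eq_bigr => i _.
  rewrite rmorphM rmorphXn -Cps // /C.
  rewrite -[puiseux_hahn (mkpuis _)]/(monomial v 1 * ps a' u) exprMn monomial_exp expr1n.
  transitivity (puiseux_hahn (A 0%N) * B0 * (monomial v 1 * monomial (- v) 1) *
      (puiseux_hahn (A i.+1) * (monomial (v *+ p ^ i.+1) 1 * ps a' u ^+ (p ^ i.+1)))).
    by rewrite AB monomialMM subrr mulr1 !mul1r.
  ring.
by rewrite uP mulr0.
Qed.

End Additive.
End PuiseuxField.

(** * Digits, kernels and Artin-Schreier equations *)

Lemma absz_le_npos (m n : int) : m <= n -> n <= 0 -> (`|n| <= `|m|)%N.
Proof. lia. Qed.

Lemma int_lt1 (m : int) : (m%:~R : rat) < 1 -> m <= 0.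
Proof. by rewrite -[1]/(1%:~R) ltr_int; lia. Qed.

(** Half-open, so that each rational is in one way an integer plus such an [r]; negative, because
    digit strings expand [- r]. *)
Definition unit_frac (r : rat) : bool := (-1 < r) && (r <= 0).

Lemma unit_frac_div r b n : unit_frac r -> (b < n)%N -> unit_frac ((r - b%:R) / n%:R).
Proof.
move=> /andP [r1 r0] bn; have n0 : (0 : rat) < n%:R by rewrite ltr0n (leq_ltn_trans _ bn).
have b0 : (0 : rat) <= b%:R by rewrite ler0n.
have : (b.+1%:R : rat) <= n%:R by rewrite ler_nat.
rewrite -natr1 => bn'; rewrite /unit_frac ltr_pdivlMr // ler_pdivrMr //.
by apply/andP; split; lra.
Qed.

Lemma unit_frac_split (q : rat) : exists (m : int) r, unit_frac r /\ q = m%:~R + r.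
Proof.
exists (Num.ceil q), (q - (Num.ceil q)%:~R); split; last by rewrite addrC subrK.
have /andP [h1 h2] := ceil_itv q.
by move: h1; rewrite rmorphB /= /unit_frac => h1; apply/andP; split; lra.
Qed.

(** The remainder is subtracted in order to match the maps [r -> (r - j) / n]: one has (m + r) / n =
    k + (r - j) / n. *)
Lemma ceil_divz (m : int) n : (0 < n)%N ->
  exists (k : int) j, (j < n)%N /\ m = n%:Z * k - j%:Z.
Proof.
move=> n0; have nz : n%:Z != 0 by rewrite eqz_nat -lt0n.
exists (- ((- m) %/ n)%Z), `|((- m) %% n)%Z|%N; split.
  have := ltz_pmod (- m) (d := n%:Z) n0; have := modz_ge0 (- m) nz; lia.
by rewrite gez0_abs ?modz_ge0 //; have := divz_eq (- m) n; lia.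
Qed.

Lemma unit_frac_int m r r' : unit_frac r -> unit_frac r' -> r' = m%:~R + r -> m = 0.
Proof.
move=> /andP [a1 a2] /andP [b1 b2] E.
have : m%:~R < 1 :> rat by lra.
have : -1 < m%:~R :> rat by lra.
by rewrite -[1]/(1%:~R) -rmorphN !ltr_int; lia.
Qed.

Section Digits.
Variable p : nat.
Hypothesis p_gt1 : (1 < p)%N.
Let p0 : (0 : rat) < p%:R. Proof. by rewrite ltr0n ltnW. Qed.

Lemma digval_cons b bs : digval p (b :: bs) = (b%:R + digval p bs) / p%:R.
Proof.
rewrite /digval big_ord_recl /= expr1 mulrDl mulr_suml; congr (_ + _).
by apply: eq_bigr => i _; rewrite exprSr invfM mulrA.
Qed.

Lemma digval_nil : digval p [::] = 0.
Proof. by rewrite /digval big_ord0. Qed.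

Lemma digval_ge0 bs : 0 <= digval p bs.
Proof.
elim: bs => [|b bs IH]; first by rewrite digval_nil.
by rewrite digval_cons divr_ge0 ?addr_ge0 ?ler0n // ltW.
Qed.

Lemma digval_lt1 bs : all (fun b => b < p)%N bs -> digval p bs < 1.
Proof.
elim: bs => [|b bs IH]; first by rewrite digval_nil.
case/andP => bp /IH lt1; rewrite digval_cons ltr_pdivrMr // mul1r.
have : (b.+1%:R : rat) <= p%:R by rewrite ler_nat.
by rewrite -natr1; lra.
Qed.

(** The summand is first added to the tail, whose carry [n1] then falls on the leading digit. A
    carry trades [p] units in one place for one unit in the place before, so the digit sum, integer
    part included, grows by at most 1. *)
Lemma digval_carry e bs : all (fun b => b < p)%N bs ->
  exists n bs', [/\ (n <= 1)%N, all (fun b => b < p)%N bs',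
    (n + sumn bs' <= (sumn bs).+1)%N &
    digval p bs + (p%:R ^+ e)^-1 = n%:R + digval p bs'].
Proof.
elim: e bs => [|e IH] bs ok.
  by exists 1%N, bs; split=> //; rewrite expr0 invr1 addrC.
have [b [bs1 [bp ok1 sb vb]]] : exists b bs1, [/\ (b < p)%N, all (fun b => b < p)%N bs1,
    sumn bs = (b + sumn bs1)%N & digval p bs = digval p (b :: bs1)].
  case: bs ok => [_|b bs1 /andP [bp ok1]]; last by exists b, bs1.
  by exists 0%N, [::]; split=> //; [exact: ltnW | rewrite digval_cons digval_nil addr0 mul0r].
have [n1 [bs1' [n11 ok1' s1 v1]]] := IH _ ok1.
have E : digval p bs + (p%:R ^+ e.+1)^-1 = ((b + n1)%:R + digval p bs1') / p%:R.
  by rewrite vb digval_cons natrD -addrA -v1 exprSr invfM !mulrDl; ring.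
have [lt|ge] := ltnP (b + n1) p.
  exists 0%N, ((b + n1) :: bs1')%N; split=> //=; first by rewrite lt.
    by rewrite sb; lia.
  by rewrite E digval_cons add0r.
have Ep : (b + n1)%N = p by lia.
exists 1%N, (0%N :: bs1'); split=> //=; first by rewrite ltnW.
  by rewrite sb; lia.
rewrite E digval_cons Ep mulrDl divff ?gt_eqF // add0r; by rewrite addrC.
Qed.

(* Repeated exponents are allowed, and carrying never increases the number of summands;
   hence the condition is stable under addition and multiplication by integers, unlike
   a condition on digits. *)
Definition digit_sum_le (c : nat) (r : rat) : Prop :=
  exists (l : seq nat) (n : int),
    (size l <= c)%N /\ r = n%:~R - \sum_(e <- l) (p%:R ^+ e)^-1.

(** The summands are added one at a time with [digval_carry]; as [r] lies in (-1, 0], the integer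
    carried out must cancel [n]. *)
Lemma digit_sum_le_digval c r : unit_frac r -> digit_sum_le c r ->
  exists2 bs, digits_ok p c bs & r = - digval p bs.
Proof.
move=> /andP [r1 r0] [l [n [lc rE]]].
have [k [bs [ok sb vb]]] : exists (k : nat) bs, [/\ all (fun b => b < p)%N bs,
    (sumn bs <= size l)%N & \sum_(e <- l) (p%:R ^+ e : rat)^-1 = k%:R + digval p bs].
  elim: (l) => [|e l' [k [bs [ok sb vb]]]].
    by exists 0%N, [::]; rewrite big_nil digval_nil addr0.
  have [n' [bs' [n1 ok' s' v']]] := digval_carry e ok.
  exists (k + n')%N, bs'; split=> //=; first by lia.
  by rewrite big_cons vb natrD -addrA -v'; ring.
exists bs; first by rewrite /digits_ok ok (leq_trans sb lc).
have v0 := digval_ge0 bs; have v1 := digval_lt1 ok.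
have nk : n = k%:Z.
  have rE' : r = (n - k%:Z)%:~R - digval p bs by rewrite rE vb rmorphB /=; ring.
  have : -1 < (n - k%:Z)%:~R :> rat by lra.
  have : (n - k%:Z)%:~R < 1 :> rat by lra.
  rewrite -[1]/(1%:~R) -rmorphN !ltr_int; lia.
by rewrite rE vb nk; ring.
Qed.

Lemma digit_sum_leD c r (k : int) : digit_sum_le c r -> digit_sum_le c (r + k%:~R).
Proof.
move=> [l [n [lc ->]]]; exists l, (n + k); split=> //.
by rewrite rmorphD /=; ring.
Qed.

Lemma digit_sum_leM c r n : digit_sum_le c r -> digit_sum_le (c * n) (r * n%:R).
Proof.
move=> [l [m [lc ->]]]; exists (flatten (nseq n l)), (m * n); split.
  by rewrite size_flatten /shape map_nseq sumn_nseq leq_mul2r lc orbT.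
rewrite rmorphM /= mulrBl; congr (_ - _).
elim: n => [|n IH]; first by rewrite mulr0 big_nil.
by rewrite /= big_cat -IH -natr1 mulrDr mulr1 addrC.
Qed.

(** After the division, [m] counts as [m] copies of p^-n. This bounds exponents that come from known
    ones by repeated division by [p]. *)
Lemma digit_sum_le_div c bs m n : digits_ok p c bs ->
  digit_sum_le (m + c) (- (m%:R + digval p bs) / p%:R ^+ n).
Proof.
case/andP => _ sb.
have [l [sl vl]] : exists l, size l = sumn bs /\
    digval p bs = \sum_(e <- l) (p%:R ^+ e : rat)^-1.
  elim: (bs) => [|b bs' [l [sl vl]]]; first by exists [::]; rewrite big_nil digval_nil.
  exists (nseq b 1%N ++ map S l); rewrite size_cat size_nseq size_map sl; split=> //.
  rewrite digval_cons big_cat big_nseq big_map mulrDl; congr (_ + _).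
    by rewrite iter_addr_0 expr1 mulr_natl.
  rewrite vl mulr_suml; apply: eq_bigr => e _.
  by rewrite exprSr invfM.
exists (nseq m n ++ map (fun e => e + n)%N l), 0; split.
  by rewrite size_cat size_nseq size_map leq_add2l sl.
rewrite add0r big_cat big_nseq big_map mulNr mulrDl; congr (- (_ + _)).
  by rewrite iter_addr_0 mulr_natl.
rewrite vl mulr_suml; apply: eq_bigr => e _.
by rewrite exprD invfM.
Qed.

End Digits.

Section Span.
Variable K : closedFieldType.

Definition span (I : finType) (W : I -> rat -> K) (f : rat -> K) : Prop :=
  exists c : I -> K, forall r, f r = \sum_i c i * W i r.

Lemma span_ext (I : finType) (W : I -> rat -> K) f g :
  (forall r, f r = g r) -> span W f -> span W g.
Proof. by move=> e [c cP]; exists c => r; rewrite -e. Qed.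

Lemma span_gen (I : finType) (W : I -> rat -> K) i : span W (W i).
Proof.
exists (fun j => (j == i)%:R) => r; rewrite (bigD1 i) //= eqxx mul1r big1 ?addr0 //.
by move=> j /negPf ->; rewrite mul0r.
Qed.

Lemma span_sum (I : finType) (W : I -> rat -> K) (J : Type) (s : seq J) (d : J -> K)
    (F : J -> rat -> K) :
  (forall j, span W (F j)) -> span W (fun r => \sum_(j <- s) d j * F j r).
Proof.
move=> sp; elim: s => [|j s [c cP]].
  by exists (fun=> 0) => r; rewrite big_nil big1 // => i _; rewrite mul0r.
have [e eP] := sp j; exists (fun i => d j * e i + c i) => r.
rewrite big_cons eP cP mulr_sumr -big_split; apply: eq_bigr => i _ /=.
by rewrite mulrDl mulrA.
Qed.

Lemma span_trans (I J : finType) (W : I -> rat -> K) (V : J -> rat -> K) f :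
  (forall i, span V (W i)) -> span W f -> span V f.
Proof.
move=> WV [c cP]; apply: span_ext (span_sum (index_enum I) c WV) => r.
by rewrite cP.
Qed.

Lemma span0 (I : finType) (W : I -> rat -> K) f : (forall r, f r = 0) -> span W f.
Proof. by move=> f0; exists (fun=> 0) => r; rewrite f0 big1 // => i _; rewrite mul0r. Qed.

Lemma spanD (I : finType) (W : I -> rat -> K) f g :
  span W f -> span W g -> span W (fun r => f r + g r).
Proof.
move=> [c cP] [d dP]; exists (fun i => c i + d i) => r.
by rewrite cP dP -big_split; apply: eq_bigr => i _; rewrite mulrDl.
Qed.

Lemma spanN (I : finType) (W : I -> rat -> K) f :
  span W f -> span W (fun r => - f r).
Proof.
move=> [c cP]; exists (fun i => - c i) => r.
by rewrite cP -sumrN; apply: eq_bigr => i _; rewrite mulNr.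
Qed.

End Span.

(** * Stable spaces and finite kernels *)

Section Kernels.
Variables (K : closedFieldType) (p : nat).
Hypothesis charp : p \in [pchar K].
Local Notation H := (hahn K).
Let p_gt1 : (1 < p)%N. Proof. exact/prime_gt1/(pcharf_prime charp). Qed.
Let p_gt0 : (0 < p)%N. Proof. exact/ltnW. Qed.
Let pQ : (p%:R : rat) != 0. Proof. by rewrite pnatr_eq0 -lt0n. Qed.

(** The extension by 0 lets identities between components, and hence spans, be stated on all
    rationals. *)
Definition component (a : nat) (m : int) (x : rat -> K) (r : rat) : K :=
  if unit_frac r then x ((m%:~R + r) / a%:R) else 0.

Definition theta (b : nat) (f : rat -> K) (r : rat) : K :=
  if unit_frac r then f ((r - b%:R) / p%:R) ^+ p else 0.

Definition theta_stable (I : finType) (W : I -> rat -> K) : Prop :=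
  (forall i r, W i r != 0 -> unit_frac r) /\
  forall i b, (b < p)%N -> span W (theta b (W i)).

(** The bound [c] is a separate clause, since the constant 1 on (-1, 0] spans a stable line and has
    unbounded digit sums. *)
Definition finite_kernel_at (a : nat) (x : H) : Prop :=
  exists (I : finType) (W : I -> rat -> K) (c : nat),
    [/\ theta_stable W, forall i r, W i r != 0 -> digit_sum_le p c r &
        forall m, span W (component a m x)].

Lemma frobK_sum (I : Type) (s : seq I) (F : I -> K) :
  (\sum_(i <- s) F i) ^+ p = \sum_(i <- s) F i ^+ p.
Proof. by rewrite -(pFrobenius_autE charp) rmorph_sum. Qed.

Lemma frobKD (u v : K) : (u + v) ^+ p = u ^+ p + v ^+ p.
Proof. by rewrite -(pFrobenius_autE charp) rmorphD. Qed.

Lemma theta_span (I : finType) (W : I -> rat -> K) b f :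
  theta_stable W -> (b < p)%N -> span W f -> span W (theta b f).
Proof.
move=> [_ st] bp [c cP].
have := @span_sum K _ W _ (index_enum I) (fun i => c i ^+ p) (fun i => theta b (W i))
  (fun i => st i b bp).
apply: span_ext => r; rewrite /theta; case: ifP => _; last first.
  by rewrite big1 // => i _; rewrite mulr0.
by rewrite cP frobK_sum; apply: eq_bigr => i _; rewrite exprMn.
Qed.

Lemma hahn_lower (x : H) : exists N : rat, forall q, x q != 0 -> N <= q.
Proof.
have [[q xq]|no] := pselect (hsupp x !=set0).
  have [m _ mP] := @hahn_well_ordered _ x (hsupp x) (fun _ h => h) (ex_intro _ q xq).
  by exists m.
by exists 0 => q xq; case: no; exists q.
Qed.

Lemma hahn_positive_gap (x : H) :
  exists2 e : rat, 0 < e & forall q, 0 < q -> x q != 0 -> e <= q.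
Proof.
have [[q [xq q0]]|no] := pselect ((hsupp x `&` [set q | 0 < q]) !=set0).
  have [|m [_ m0] mP] := @hahn_well_ordered _ x (hsupp x `&` [set q | 0 < q]) _ (ex_intro _ q
      (conj xq q0)).
    by move=> ? [].
  by exists m => // r r0 xr; apply: mP.
by exists 1 => // q q0 xq; case: no; exists q.
Qed.

Lemma finite_kernel_at0 : finite_kernel_at 1 0.
Proof.
exists 'I_0, (fun _ _ => 0), 0%N; split; first split.
- by move=> i r; rewrite eqxx.
- by move=> i; case: i.
- by move=> i r; rewrite eqxx.
by move=> m; apply: span0 => r; rewrite /component; case: ifP.
Qed.

(** With [m = n k - j], the component of index [m] for the denominator [a n] is the component of
    index [k] for [a], taken at [(r - j) / n]. This stretching multiplies digit sums by at most
    [n]. *)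
Lemma finite_kernel_at_refine a n (x : H) : (0 < n)%N -> finite_kernel_at a x ->
    finite_kernel_at (a * n) x.
Proof.
move=> n0 [I [W [c [[_ stW] dW cW]]]].
have nQ : (n%:R : rat) != 0 by rewrite pnatr_eq0 -lt0n.
pose V (ij : I * 'I_n) (r : rat) : K :=
  if unit_frac r then W ij.1 ((r - (ij.2 : nat)%:R) / n%:R) else 0.
have spV f (j : 'I_n) : span W f ->
    span V (fun r => if unit_frac r then f ((r - (j : nat)%:R) / n%:R) else 0).
  move=> [d dP].
  apply: span_ext (span_sum (index_enum I) d (fun i => span_gen V (i, j))) => r.
  rewrite /V /=; case: ifP => _; first by rewrite dP.
  by rewrite big1 // => i _; rewrite mulr0.
exists (I * 'I_n)%type, V, (c * n)%N; split; first split.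
- by move=> ij r; rewrite /V; case: ifP => //; rewrite eqxx.
- move=> [i j] b bp.
  (* [theta b] of the stretch [j] evaluates at [(r - s) / (p n)]. Dividing [s] by [n] turns this
     into [theta] at the quotient, stretched with the remainder; the quotient is below [p] because
     [s < p n]. *)
  pose s := (b + p * j)%N.
  have b'p : (s %/ n < p)%N.
    rewrite ltn_divLR // /s; have := ltn_ord j; nia.
  have j'n : (s %% n < n)%N by rewrite ltn_mod.
  apply: span_ext (spV _ (Ordinal j'n) (stW i _ b'p)) => r.
  rewrite /theta /V /=; case: ifP => fr //.
  rewrite !unit_frac_div //; congr (W i _ ^+ p).
  have Es : (s%:R : rat) = (s %/ n)%:R * n%:R + (s %% n)%:R.
    by rewrite -natrM -natrD -divn_eq.
  have Es' : (s%:R : rat) = b%:R + p%:R * j%:R by rewrite /s natrD natrM.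
  have -> : (s %% n)%:R = b%:R + p%:R * j%:R - (s %/ n)%:R * n%:R :> rat by lra.
  by field; rewrite pQ nQ.
- move=> [i j] r; rewrite /V /=; case: ifP => [fr /dW|_]; last by rewrite eqxx.
  move/(digit_sum_leM n)/(digit_sum_leD (j : nat)); rewrite divfK // => h.
  by have -> : r = r - (j : nat)%:R + (j : nat)%:~R by rewrite subrK.
move=> m; have [k [j [jn ->]]] := ceil_divz m n0.
apply: span_ext (spV _ (Ordinal jn) (cW k)) => r.
rewrite /component; case: ifP => // fr; rewrite unit_frac_div //; congr (x _).
have -> : k%:~R + (r - j%:R) / n%:R = ((n%:Z * k - j%:Z)%:~R + r) / n%:R :> rat.
  by rewrite rmorphB rmorphM /=; field.
by rewrite natrM invfM; ring.
Qed.

(** The exponents of [y] are integers over [a], so multiplication by [y] only shifts the index of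
    the components of [x]. Finitely many shifts contribute, both supports being bounded below; [L]
    does not depend on [r] because [r <= 0]. *)
Lemma finite_kernel_atM (a : nat) (y x : H) : (0 < a)%N -> laurent_at a y ->
    finite_kernel_at a x ->
  finite_kernel_at a (y * x).
Proof.
move=> a0 [N NP] [I [W [c [st dW cW]]]]; exists I, W, c; split=> // m.
have aQ : (0 : rat) < a%:R by rewrite ltr0n.
have [M MP] := hahn_lower x.
pose L := (`|Num.ceil (m%:~R - M * a%:R - N%:~R)|)%N.
have LP : m%:~R - M * a%:R - N%:~R <= L%:R :> rat.
  by apply: le_trans (ceil_ge _) _; rewrite natr_absz ler_int ler_norm.
have := @span_sum K _ W _ (index_iota 0 L.+1) (fun l : nat => y ((N + l)%:~R / a%:R))
  (fun l : nat => component a (m - (N + l)) x) (fun l => cW _).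
apply: span_ext => r; rewrite /component; case: ifP => fr; last first.
  by rewrite big1 // => i _; rewrite mulr0.
rewrite hahnME (@hmul_seq _ _ _ _ [seq (N + l%:Z)%:~R / a%:R | l <- index_iota 0 L.+1]).
- rewrite big_map; apply: eq_bigr => l _; congr (_ * x _).
  by rewrite -mulrBl rmorphB /=; congr (_ / _); ring.
- rewrite map_inj_uniq ?iota_uniq // => i j /(mulIf (invr_neq0 (lt0r_neq0 aQ))) /intr_inj; lia.
move=> i /NP [n [Nn ->]] /MP le; apply/mapP; exists `|n - N|%N; last first.
  by congr (_%:~R / _); lia.
rewrite mem_index_iota /= ltnS -lez_nat.
have -> : `|n - N|%N%:Z = n - N by lia.
rewrite -(ler_int rat) rmorphB /=; apply: le_trans LP.
move: le; rewrite -mulrBl ler_pdivlMr //.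
by case/andP: fr => _ r0; lra.
Qed.

(** This is z^p = z + y read at the exponent (p m - b + r) / a. *)
Lemma theta_component a m (z y : H) : z ^+ p - z = y -> forall b r, (b < p)%N ->
  theta b (component a m z) r = component a (p%:Z * m - b%:Z) z r +
      component a (p%:Z * m - b%:Z) y r.
Proof.
move=> zy b r bp; rewrite /theta /component; case: ifP => fr; last by rewrite addr0.
rewrite unit_frac_div // [RHS]addrC -zy hahnBE subrK (hahn_frobE charp); congr (z _ ^+ p).
have -> : m%:~R + (r - b%:R) / p%:R = ((p%:Z * m - b%:Z)%:~R + r) / p%:R :> rat.
  by rewrite rmorphB rmorphM /=; field.
by ring.
Qed.

Lemma thetaD b f g r : theta b (fun s => f s + g s) r = theta b f r + theta b g r.
Proof. by rewrite /theta; case: ifP => _; rewrite ?addr0 // frobKD. Qed.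

Lemma theta_ext b f g r : (forall s, f s = g s) -> theta b f r = theta b g r.
Proof. by rewrite /theta => ->. Qed.

(** For [s = (r - (p - 1)) / p] one has [s + 1 = (r + 1) / p], so the iterates evaluate [f] closer
    and closer to -1. *)
Lemma theta_top_iter N f r : iter N (theta p.-1) f r != 0 -> (0 < N)%N ->
  exists s, [/\ unit_frac r, s + 1 = (r + 1) / p%:R ^+ N & f s != 0].
Proof.
elim: N r => // N IH r; rewrite iterS /theta; case: ifP => [fr|_]; last by rewrite eqxx.
have e : (r - p.-1%:R) / p%:R + 1 = (r + 1) / p%:R.
  have -> : (p.-1%:R : rat) = p%:R - 1 by rewrite -[in RHS](prednK p_gt0) -natr1 addrK.
  by field.
rewrite expf_eq0 p_gt0 /= => nz _; case: N IH nz => [_ nz|N IH nz].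
  by exists ((r - p.-1%:R) / p%:R); rewrite expr1.
have [s [_ es fs]] := IH _ nz isT; exists s; split=> //.
by rewrite es e [in RHS]exprS invfM mulrA.
Qed.

(* Only the component [z_1] is not reached directly: [z_1 = theta_(p-1) z_1 - y_1] is iterated,
   and [theta_(p-1)^N z_1 = 0] for large [N] because it involves arbitrarily small positive
   exponents of [z]. *)
Lemma finite_kernel_artin_schreier a (z y : H) : (0 < a)%N -> z ^+ p - z = y ->
  finite_kernel_at a y -> finite_kernel_at a z.
Proof.
move=> a0 zy [I [W [c [stW dW cW]]]].
have aQ : (0 : rat) < a%:R by rewrite ltr0n.
have th := theta_component _ _ zy.
have [M MP] := hahn_lower z.
have zlow : exists L : nat, forall m : int, m <= - L%:Z -> forall r, component a m z r = 0.
  exists (`|Num.floor (M * a%:R)|.+1)%N => m mL r; rewrite /component; case: ifP =>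
      // /andP [_ r0].
  apply/eqP/negPn/negP => /MP; rewrite ler_pdivlMr // => h.
  have := le_trans (floor_le _) h; rewrite -[m%:~R + r]addr0 => h1.
  have : (Num.floor (M * a%:R))%:~R <= m%:~R :> rat by lra.
  by rewrite ler_int; lia.
have [L LP] := zlow.
(* The indices [m <= 0] are stable under m -> p m - b, and only those above [- L] can give nonzero
   components; so finitely many of them complete [W]. *)
pose V (i : I + 'I_L) := match i with inl i => W i | inr l => component a (- (l : nat)%:Z) z end.
have WV f : span W f -> span V f.
  by apply: span_trans => i; exact: (span_gen V (inl i)).
have nonpos m : m <= 0 -> span V (component a m z).
  move=> m0; have [lt|ge] := ltnP `|m|%N L.
    have E : m = - (`|m|%N)%:Z by lia.
    by have := span_gen V (inr (Ordinal lt)); rewrite [V _]/= -E.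
  by apply: span0 => r; apply: LP; lia.
have stV : theta_stable V.
  split; first by case=> [i|l] r /=; [exact: stW.1 | rewrite /component; case: ifP;
      rewrite ?eqxx].
  move=> [i|l] b bp /=; first by apply: WV; apply: stW.2.
  have := spanD (nonpos (p%:Z * - (l : nat)%:Z - b%:Z) _) (WV _ (cW (p%:Z *
      - (l : nat)%:Z - b%:Z))).
  move/(_ ltac:(nia)); apply: span_ext => r; exact/esym/th.
have one : span W (component a 1 z).
  have [e e0 eP] := hahn_positive_gap z.
  have step N : exists2 g, span W g & forall r, component a 1 z r =
      iter N (theta p.-1) (component a 1 z) r + g r.
    have E : p%:Z * 1 - p.-1%:Z = 1 by lia.
    elim: N => [|N [g sg gP]].
      by exists (fun=> 0) => [|r]; [exact: span0 | rewrite addr0].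
    exists (fun r => theta p.-1 g r - component a 1 y r).
      by apply: spanD; [apply: theta_span => //; rewrite prednK | exact: spanN].
    move=> r; rewrite iterS addrA -thetaD -(theta_ext _ _ gP) th ?prednK // E.
    by rewrite addrK.
  have [N N0 NP] : exists2 N, (0 < N)%N & (a%:R * e)^-1 < N%:R :> rat.
    exists (`|Num.ceil (a%:R * e)^-1|).+1%N => //.
    apply: le_lt_trans (ceil_ge _) _.
    apply: (@le_lt_trans _ _ (`|Num.ceil (a%:R * e)^-1|)%N%:R).
      by rewrite natr_absz ler_int ler_norm.
    by rewrite ltr_nat.
  have [g sg gP] := step N; apply: span_ext sg => r; rewrite gP.
  suff -> : iter N (theta p.-1) (component a 1 z) r = 0 by rewrite add0r.
  apply/eqP/negPn/negP => /theta_top_iter /(_ N0) [s [/andP [r1 r0] es]].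
  rewrite /component; case: ifP => [_|]; last by rewrite eqxx.
  have pN : (0 : rat) < p%:R ^+ N by rewrite exprn_gt0 // ltr0n.
  have r10 : 0 < r + 1 by rewrite -ltrBlDr sub0r.
  have r11 : r + 1 <= 1 by rewrite gerDr.
  have s0 : 0 < s + 1 by rewrite es; exact: divr_gt0.
  have s1 : s + 1 <= (p%:R ^+ N)^-1.
    by rewrite es ler_pdivrMr // mulVf // gt_eqF.
  have q0 : 0 < (1%:~R + s) / a%:R by rewrite divr_gt0 //; rewrite addrC.
  move/(eP _ q0); rewrite ler_pdivlMr // [_ + s]addrC => h.
  have h1 := le_trans h s1.
  have ae : 0 < a%:R * e by rewrite mulr_gt0.
  have : p%:R ^+ N <= (a%:R * e)^-1 by rewrite -[p%:R ^+ N]invrK lef_pV2 ?posrE ?invr_gt0 //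
      mulrC.
  apply/negP; rewrite -ltNge; apply: lt_trans NP _.
  by rewrite -natrX ltr_nat; exact: ltn_expl.
(* If [m >= 2] then [m = p k - b] with [0 < k < m], and [theta_component] obtains index [m] from
   index [k]. For [m = 1] this gives [k = 1], hence the separate treatment above. *)
have all m : span V (component a m z).
  have [m0|mpos] := leP m 0; first exact: nonpos.
  have -> : m = `|m|%N by lia.
  move: {m mpos} `|m|%N; elim/ltn_ind => -[|[|m]] IH.
  - exact: nonpos.
  - exact: WV.
  have [k [b [bp E]]] := ceil_divz m.+2 p_gt0.
  have k0 : 0 < k by nia.
  have km : (`|k| < m.+2)%N by nia.
  have := spanD (theta_span stV bp (IH _ km)) (spanN (WV _ (cW m.+2))).
  apply: span_ext => r; rewrite th // gez0_abs; last lia.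
  by rewrite -E addrK.
have [M' MP'] := hahn_lower y.
pose B := `|Num.floor (M' * a%:R)|.+1%N.
exists (I + 'I_L)%type, V, (B + c)%N; split=> //.
have digit_sum_mono c1 c2 r : (c1 <= c2)%N -> digit_sum_le p c1 r -> digit_sum_le p c2 r.
  by move=> le [l [n [lc ->]]]; exists l, n; split=> //; exact: leq_trans le.
(* Repeated multiplication by [p] takes a negative exponent of [z] to an exponent of [y], since
   otherwise the support of [z] would contain an infinite descent. Thus [q] is an exponent of [y]
   divided by a power of [p], and [B] bounds the integer part of that exponent times [a]. *)
have key q : q <= 0 -> z q != 0 -> digit_sum_le p (B + c) (q * a%:R).
  rewrite le_eqVlt => /predU1P [-> _|q0 zq].
    by exists [::], 0; rewrite big_nil mul0r subr0.
  have [n yn] : exists n : nat, y (q * p%:R ^+ n) != 0.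
    apply: contrapT => no.
    have zn n : z (q * p%:R ^+ n) != 0.
      elim: n => [|n IH]; first by rewrite expr0 mulr1.
      apply/eqP => z0; apply: no; exists n.+1; rewrite -zy hahnBE z0 subr0.
      by rewrite (hahn_frobE charp) exprSr mulrA mulfK // expf_neq0.
    have [||m [n _ En] mP] := @hahn_well_ordered _ z [set q * p%:R ^+ n | n in [set: nat]].
    - by move=> _ [n _ <-]; exact: zn.
    - by exists (q * p%:R ^+ 0), 0%N.
    have : m <= q * p%:R ^+ n.+1 by apply: mP; exists n.+1.
    apply/negP; rewrite -ltNge -En exprSr mulrA gtr_nMr ?ltr1n //.
    by rewrite nmulr_rlt0 // exprn_gt0 // ltr0n.
  have [m [r [fr mr]]] := unit_frac_split (q * p%:R ^+ n * a%:R).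
  have pn : (0 : rat) < p%:R ^+ n by rewrite exprn_gt0 // ltr0n.
  have cy : component a m y r != 0.
    by rewrite /component fr -mr mulfK // gt_eqF.
  have [d dP] := cW m.
  have [i Wi] : exists i, W i r != 0.
    apply: contrapT => no; move/negP: cy; apply; rewrite dP big1 // => i _.
    have [->|nz] := eqVneq (W i r) 0; first by rewrite mulr0.
    by case: no; exists i.
  have [bs ok rE] := digit_sum_le_digval p_gt1 fr (dW _ _ Wi).
  have mneg : m <= 0.
    have : q * p%:R ^+ n * a%:R < 0 by rewrite pmulr_llt0 // pmulr_llt0.
    rewrite mr; case/andP: fr => r1 _ h.
    by apply: int_lt1; lra.
  have mB : (`|m| <= B)%N.
    have := MP' _ yn; rewrite -(ler_pM2r aQ) mr => h.
    have := le_trans (floor_le _) h; case/andP: fr => _ r0 h1.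
    have h2 : Num.floor (M' * a%:R) <= m by rewrite -(ler_int rat) (le_trans h1) // gerDl.
    exact: leqW (absz_le_npos h2 mneg).
  have := digit_sum_le_div `|m|%N n ok.
  have -> : - (`|m|%N%:R + digval p bs) / p%:R ^+ n = q * a%:R.
    rewrite natr_absz ler0_norm // rmorphN /= opprD opprK -rE -mr.
    by rewrite mulrAC mulfK // gt_eqF.
  by apply: digit_sum_mono; rewrite leq_add2r.
case=> [i|l] r /=.
  by move/dW; apply: digit_sum_mono; rewrite leq_addl.
rewrite /component; case: ifP => [/andP [_ r0]|]; last by rewrite eqxx.
move/key; rewrite divfK ?gt_eqF // => h.
have : (- (l : nat)%:Z)%:~R + r <= 0 :> rat.
  have : (0 : rat) <= (l : nat)%:R by rewrite ler0n.
  by rewrite rmorphN /=; lra.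
move=> le0; have /h : ((- (l : nat)%:Z)%:~R + r) / a%:R <= 0 by rewrite pmulr_lle0 ?invr_gt0.
move/(digit_sum_leD (l : nat)); rewrite rmorphN /= addrAC addNr add0r; exact.
Qed.

End Kernels.

(** * Integral series have finite kernels *)

(** When the [A i] add up to 0, only the differences of the [T i] remain; with T_i = z^(p^i) these
    are the powers of z^p - z. *)
Lemma sum_by_parts (R : comNzRingType) (A T : nat -> R) n :
  \sum_(i < n.+1) A i * T i = (\sum_(i < n.+1) A i) * T 0%N +
    \sum_(i < n) (\sum_(i.+1 <= j < n.+1) A j) * (T i.+1 - T i).
Proof.
elim: n => [|n IH]; first by rewrite !big_ord_recl !big_ord0 !addr0.
rewrite big_ord_recr /= {}IH [in RHS]big_ord_recr /=.
have -> : \sum_(i < n.+1) (\sum_(i.+1 <= j < n.+2) A j) * (T i.+1 - T i) =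
    \sum_(i < n) (\sum_(i.+1 <= j < n.+1) A j) * (T i.+1 - T i)
    + A n.+1 * (T n.+1 - T 0%N).
  transitivity (\sum_(i < n.+1) ((\sum_(i.+1 <= j < n.+1) A j) * (T i.+1 - T i)
      + A n.+1 * (T i.+1 - T i))).
    by apply: eq_bigr => i _; rewrite big_nat_recr ?ltn_ord //= mulrDl.
  rewrite big_split /= big_ord_recr /= big_geq // mul0r addr0; congr (_ + _).
  by rewrite -mulr_sumr -(big_mkord xpredT (fun i => T i.+1 - T i)) telescope_sumr.
by ring.
Qed.

Section Integral.
Variables (K : closedFieldType) (p : nat).
Hypothesis charp : p \in [pchar K].
Local Notation H := (hahn K).
Local Notation E := (puiseux K).
Let p_gt1 : (1 < p)%N. Proof. exact/prime_gt1/(pcharf_prime charp). Qed.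
Let p_gt0 : (0 < p)%N. Proof. exact/ltnW. Qed.
Let pQ : (p%:R : rat) != 0. Proof. by rewrite pnatr_eq0 -lt0n. Qed.

(** Coefficients are replaced by p-th roots and exponents divided by [p], which only changes the
    denominator from [a] to [a p]. *)
Lemma puis_frob_surj (d : E) : exists e : E, e ^+ p = d.
Proof.
have root_ex (c : K) : exists r : K, r ^+ p = c.
  have [|r /rootP] := closed_rootP ('X^p - c%:P) _.
    by rewrite size_XnsubC // eqSS -lt0n.
  by rewrite !hornerE => /eqP; rewrite subr_eq0 => /eqP <-; exists r.
pose f (q : rat) : K := projT1 (cid (root_ex (puiseux_hahn _ d (q * p%:R)))).
have fE q : f q ^+ p = puiseux_hahn _ d (q * p%:R) by rewrite /f; case: cid.
have f0 q : f q != 0 -> puiseux_hahn _ d (q * p%:R) != 0.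
  by rewrite -fE expf_eq0 p_gt0.
have wf : well_ordered (hsupp f).
  move=> B sB [b Bb].
  have [||m [q Bq <-] mP] := @hahn_well_ordered _ (puiseux_hahn _ d) [set q * p%:R | q in B].
  - by move=> _ [q /sB /f0 h <-].
  - by exists (b * p%:R), b.
  exists q => // b' Bb'; have : q * p%:R <= b' * p%:R by apply: mP; exists b'.
  by rewrite ler_pM2r // ltr0n.
have [a [a0 [N NP]]] := puisP d.
have px : is_puiseux (mkhahn wf).
  exists (a * p)%N; split; first by rewrite muln_gt0 a0.
  exists N => q /f0 /NP [n [Nn En]]; exists n; split=> //.
  by rewrite natrM invfM mulrA -En mulfK.
exists (mkpuis px); apply: val_inj.
rewrite -[LHS]/(puiseux_hahn _ (mkpuis px ^+ p)) rmorphXn; apply: hahnP => q.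
by rewrite (hahn_frobE charp) -[puiseux_hahn _ (mkpuis px)]/(mkhahn wf) [mkhahn _ _]/= fE divfK.
Qed.

Lemma puis_frob_iter_surj k (d : E) : exists e : E, e ^+ (p ^ k) = d.
Proof.
elim: k d => [|k IH] d; first by exists d; rewrite expn0 expr1.
have [e <-] := puis_frob_surj d; have [e' <-] := IH e.
by exists e'; rewrite expnSr exprM.
Qed.

Definition finite_kernel (x : H) : Prop := exists2 a : nat, (0 < a)%N & finite_kernel_at p a x.

Lemma finite_kernelM (y : E) (x : H) : finite_kernel x -> finite_kernel (puiseux_hahn _ y * x).
Proof.
move=> [a a0 ax]; have [b [b0 ly]] := puisP y.
exists (a * b)%N; first by rewrite muln_gt0 a0.
apply: (finite_kernel_atM charp); first by rewrite muln_gt0 a0.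
  by rewrite mulnC; apply: laurent_at_scale.
exact: (finite_kernel_at_refine charp).
Qed.

Lemma frob_iterB (u v : H) i : (u - v) ^+ (p ^ i) = u ^+ (p ^ i) - v ^+ (p ^ i).
Proof.
elim: i => [|i IH]; first by rewrite expn0 !expr1.
rewrite expnSr !exprM IH -!(pFrobenius_autE (hahn_pchar charp)).
by rewrite rmorphB.
Qed.

Lemma frob_iter_sum (I : Type) (r : seq I) (F : I -> H) i :
  (\sum_(j <- r) F j) ^+ (p ^ i) = \sum_(j <- r) F j ^+ (p ^ i).
Proof.
elim: i => [|i IH]; first by rewrite expn0 expr1; apply: eq_bigr => j _; rewrite expr1.
rewrite expnSr exprM IH -(pFrobenius_autE (hahn_pchar charp)) rmorph_sum.
by apply: eq_bigr => j _; rewrite exprM.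
Qed.

(* Writing [x = y z] with [y] a root of the operator turns it into an operator of
   smaller order annihilating [z^p - z]. *)
Lemma finite_kernel_additive r (A : nat -> E) (x : H) : A 0%N != 0 ->
  \sum_(i < r.+1) puiseux_hahn _ (A i) * x ^+ (p ^ i) = 0 -> finite_kernel x.
Proof.
have zero (B : nat -> E) (y : H) : B 0%N != 0 -> puiseux_hahn _ (B 0%N) * y = 0 ->
    finite_kernel y.
  move=> B0 h; exists 1%N => //; suff -> : y = 0 by exact: finite_kernel_at0.
  by rewrite -[y]mul1r -(rmorph1 (puiseux_hahn K)) -(mulVf B0) rmorphM -mulrA h mulr0.
elim: r A x => [|r IH] A x A0.
  by rewrite big_ord_recl big_ord0 addr0 expn0 expr1; exact: zero.
have [[i0 [i0r Ai0]]|none] := pselect (exists i, (i < r.+1)%N /\ A i.+1 != 0); last first.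
  rewrite big_ord_recl big1 ?addr0 ?expn0 ?expr1; first exact: zero.
  move=> i _; suff -> : A (lift ord0 i) = 0 by rewrite rmorph0 mul0r.
  by apply/eqP/negPn/negP => Ai; apply: none; exists i.
have [y y0 yP] := additive_root charp A0 i0r Ai0.
pose A' i := A i * y ^+ (p ^ i).
have [z xE] : exists z, x = puiseux_hahn _ y * z.
  by exists (puiseux_hahn _ y^-1 * x); rewrite mulrA -rmorphM divff // rmorph1 mul1r.
(* These tail sums are the coefficients that summation by parts produces. As all the [A' i] add up
   to 0, [D 0] is the opposite of [A' 0], which is nonzero. *)
pose D i := \sum_(i.+1 <= j < r.+2) A' j.
move=> xP; rewrite xE; apply: finite_kernelM.
have wP : \sum_(i < r.+1) puiseux_hahn _ (D i) * (z ^+ p - z) ^+ (p ^ i) = 0.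
  have := sum_by_parts (fun i => puiseux_hahn _ (A' i)) (fun i => z ^+ (p ^ i)) r.+1.
  have -> : \sum_(i < r.+2) puiseux_hahn _ (A' i) * z ^+ (p ^ i) = 0.
    rewrite -[RHS]xP; apply: eq_bigr => i _.
    by rewrite /A' xE exprMn rmorphM rmorphXn mulrA.
  have -> : \sum_(i < r.+2) puiseux_hahn _ (A' i) = 0 by rewrite -rmorph_sum yP rmorph0.
  rewrite mul0r add0r => E1; rewrite [RHS]E1.
  apply: eq_bigr => i _; rewrite rmorph_sum; congr (_ * _).
  by rewrite frob_iterB -exprM expnS.
have D0 : D 0%N != 0.
  have : A' 0%N + D 0%N = 0.
    by rewrite /D -big_ltn // big_mkord; exact: yP.
  move=> E0; apply/eqP => D0; move/eqP: E0; rewrite D0 addr0 mulf_eq0 (negPf A0).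
  by rewrite expf_eq0 (negPf y0) andbF.
have [a a0 aw] := IH D _ D0 wP.
by exists a => //; exact: (finite_kernel_artin_schreier charp a0 erefl aw).
Qed.

Lemma finite_kernel_algebraic (P : {poly E}) (x : H) :
  P \is monic -> root (map_poly (puiseux_hahn K) P) x -> finite_kernel x.
Proof.
move=> monP /rootP rP; pose n := (size P).-1.
have sP : size P = n.+1 by rewrite prednK // size_poly_gt0 monic_neq0.
(* Row [i] holds the coordinates of x^(p^i) on 1, ..., x^(n-1). There are more rows than columns, so
   some nonzero [d] kills the matrix. *)
pose c : 'M[E]_(n.+1, n) := \matrix_(i, j) ('X^(p ^ i) %% P)`_j.
have xE i : x ^+ (p ^ i) = \sum_(j < n) puiseux_hahn _ (('X^(p ^ i) %% P)`_j) * x ^+ j.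
  have -> : x ^+ (p ^ i) = (map_poly (puiseux_hahn K) ('X^(p ^ i) %% P)).[x].
    have /(congr1 (fun Q => (map_poly (puiseux_hahn K) Q).[x])) := divp_eq 'X^(p ^ i) P.
    by rewrite map_polyXn hornerXn rmorphD rmorphM /= hornerD hornerM rP mulr0 add0r.
  rewrite (@horner_coef_wide _ n); first by apply: eq_bigr => j _; rewrite coef_map.
  rewrite (leq_trans (size_poly _ _)) // -ltnS -sP ltn_modp.
  exact: monic_neq0.
have [d d0 dc] : exists2 d : 'rV[E]_n.+1, d != 0 & d *m c = 0.
  have /rowV0Pn [d /sub_kermxP dc d0] : kermx c != 0.
    by rewrite -mxrank_eq0 mxrank_ker subn_eq0 -ltnNge ltnS rank_leq_col.
  by exists d.
have dx : \sum_(i < n.+1) puiseux_hahn _ (d 0 i) * x ^+ (p ^ i) = 0.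
  under eq_bigr => i _ do rewrite xE mulr_sumr.
  rewrite exchange_big big1 //= => j _.
  have dcj : puiseux_hahn _ ((d *m c) 0 j) * x ^+ j = 0 by rewrite dc mxE rmorph0 mul0r.
  rewrite -[RHS]dcj.
  rewrite mxE rmorph_sum mulr_suml; apply: eq_bigr => i _.
  by rewrite [c _ _]mxE rmorphM mulrA.
pose B (i : nat) : E := if insub i is Some j then d 0 j else 0.
have BP (i : 'I_n.+1) : B i = d 0 i by rewrite /B valK.
have exB : exists i, (i < n.+1)%N && (B i != 0).
  have /rV0Pn [i di] := d0.
  by exists i; rewrite ltn_ord BP.
(* The relation starts at x^(p^k). Its coefficients are p^k-th powers, so it is the p^k-th power of
   a relation whose coefficient at x itself is nonzero. *)
case: (ex_minnP exB) => k /andP [kn Bk] kmin.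
have [C CP] : exists C : nat -> E, forall i, C i ^+ (p ^ k) = B (i + k)%N.
  exists (fun i => projT1 (cid (puis_frob_iter_surj k (B (i + k)%N)))) => i.
  by case: cid.
apply: (@finite_kernel_additive (n - k) C).
  by apply/eqP => C0; move: Bk; rewrite -[k]add0n -CP C0 expr0n expn_eq0 -leqn0 leqNgt p_gt0 eqxx.
have frob_inj (u : H) j : u ^+ (p ^ j) = 0 -> u = 0.
  elim: j u => [|j IH] u; first by rewrite expn0 expr1.
  rewrite expnSr exprM => h; apply: IH; apply: (hahn_frob_inj charp).
  by rewrite h expr0n gtn_eqF.
apply: (frob_inj _ k); rewrite frob_iter_sum -[RHS]dx.
transitivity (\sum_(0 <= i < n.+1) puiseux_hahn _ (B i) * x ^+ (p ^ i)); last first.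
  by rewrite big_mkord; apply: eq_bigr => i _; rewrite BP.
rewrite (big_cat_nat (n := k)) //; last exact: ltnW.
rewrite [X in _ = X + _]big_nat_cond [X in _ = X + _]big1 ?add0r; last first.
  move=> i /andP [/andP [_ ik] _]; suff -> : B i = 0 by rewrite rmorph0 mul0r.
  apply/eqP/negPn/negP => Bi.
  by have := kmin i; rewrite Bi (ltn_trans ik kn) leqNgt ik => /(_ isT).
transitivity (\sum_(0 <= i < n.+1 - k) puiseux_hahn _ (B (i + k)%N) * x ^+ (p ^ (i + k)));
    last first.
  by rewrite -(big_addn 0 _ k xpredT (fun i => puiseux_hahn _ (B i) * x ^+ (p ^ i))) add0n.
rewrite subSn // big_mkord; apply: eq_bigr => i _.
by rewrite -CP exprMn rmorphXn -exprM expnD.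
Qed.

Lemma laurent_well_ordered (y : rat -> K) : laurent y -> well_ordered (hsupp y).
Proof.
move=> [N NP] B sB [b Bb].
have ex : exists n : nat, `[< B ((N + n%:Z)%:~R) >].
  have [n [En Nn]] := NP _ (sB _ Bb); exists `|n - N|%N; apply/asboolP.
  have -> : N + `|n - N|%N = n by lia.
  by rewrite -En.
case: (ex_minnP ex) => m /asboolP Bm minm; exists ((N + m%:Z)%:~R) => // c Bc.
have [n [En Nn]] := NP _ (sB _ Bc); rewrite En ler_int.
have : (m <= `|n - N|%N)%N.
  apply: minm; apply/asboolP.
  have -> : N + `|n - N|%N = n by lia.
  by rewrite -En.
lia.
Qed.

Lemma laurent_at_1P (y : H) : laurent y <-> laurent_at 1 y.
Proof.
split=> -[N NP]; exists N => q /NP [n].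
  by case=> -> Nn; exists n; rewrite divr1.
by case=> Nn ->; exists n; rewrite divr1.
Qed.

Lemma integral_finite_kernel (x : H) : integral_over_laurent x -> finite_kernel x.
Proof.
move=> [n [a [la aP]]].
pose ah j : H := mkhahn (laurent_well_ordered (la j)).
have pa j : is_puiseux (ah j) by exists 1%N; split=> //; apply/laurent_at_1P; exact: la.
pose P : {poly E} := 'X^n + \poly_(j < n) mkpuis (pa j).
apply: (@finite_kernel_algebraic P).
  rewrite monicE /P lead_coefDl ?lead_coefXn // size_polyXn ltnS; exact: size_poly.
have -> : map_poly (puiseux_hahn K) P = 'X^n + \poly_(j < n) ah j.
  apply/polyP => i; rewrite /P coef_map !coefD !coef_poly !coefXn raddfD.
  congr (_ + _); first exact: (rmorph_nat (puiseux_hahn K)).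
  by case: ifP => _; rewrite ?raddf0.
apply/rootP; rewrite hornerD hornerXn (@horner_coef_wide _ n); last exact: size_poly.
apply: hahnP => k; rewrite hahnDE hahnXE hahn_sumE hahn0E -[RHS](aP k).
congr (_ + _); apply: eq_bigr => j _.
by rewrite coef_poly ltn_ord hahnME hahnXE.
Qed.

End Integral.

(** * Finite kernels over an algebraic closure of a prime field *)

Lemma pigeonhole (T : finType) (f : nat -> T) : exists i j, (i < j)%N /\ f i = f j.
Proof.
have /injectivePn [i [j ij fij]] : ~~ injectiveb (fun i : 'I_#|T|.+1 => f i).
  by apply/negP => /injectiveP /leq_card; rewrite card_ord ltnn.
have [lt|gt|/val_inj E] := ltngtP i j.
- by exists i, j.
- by exists j, i.
by rewrite E eqxx in ij.
Qed.

Section Words.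
Variable p : nat.
Hypothesis p_gt1 : (1 < p)%N.

(* Puts the digits [u] in front of the base [p] expansion of [- r]. *)
Definition prep (u : seq nat) (r : rat) : rat :=
  foldr (fun b s => (s - b%:R) / p%:R) r u.

Lemma unit_frac_prep u r : all (fun b => b < p)%N u -> unit_frac r -> unit_frac (prep u r).
Proof. by elim: u => //= b u IH /andP [bp up] fr; apply: unit_frac_div => //; exact: IH. Qed.

Lemma unit_frac_zeros r n : unit_frac r -> unit_frac (r / p%:R ^+ n).
Proof.
move=> fr; elim: n => [|n IH]; first by rewrite expr0 divr1.
by have := unit_frac_div IH (ltnW p_gt1); rewrite subr0 exprSr invfM mulrA.
Qed.

Lemma prep_digval u bs : prep u (- digval p bs) = - digval p (u ++ bs).
Proof.
elim: u => //= b u ->.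
by rewrite digval_cons -mulNr opprD addrC.
Qed.

(** Division of the tail by p^n inserts [n] zeros after the first [j] digits, which translates the
    definition into words. *)
Lemma twist_argE j bs n :
  twist_arg p j bs n = prep (take j bs) (- digval p (drop j bs) / p%:R ^+ n).
Proof.
elim: bs j => [|b bs IH] [|j].
- by rewrite /twist_arg /= big_ord0 digval_nil oppr0 mul0r.
- by rewrite /twist_arg /= big_ord0 digval_nil oppr0 mul0r.
- rewrite /twist_arg /digval /= mulNr mulr_suml; congr (- _).
  by apply: eq_bigr => i _; rewrite exprD invfM mulrA.
rewrite [drop _ _]/= [take _ _]/= /= -IH /twist_arg big_ord_recl /= addn0 expr1.
rewrite opprD mulrBl mulNr mulr_suml addrC; congr (- _ - _).
by apply: eq_bigr => i _; rewrite exprSr invfM mulrA.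
Qed.

Lemma unit_frac_digval bs : all (fun b => b < p)%N bs -> unit_frac (- digval p bs).
Proof.
move=> ok; have v0 := digval_ge0 p bs; have v1 := digval_lt1 p_gt1 ok.
by rewrite /unit_frac ltrN2 v1 oppr_le0.
Qed.

End Words.

Section FrobeniusPowers.
Variables (K : closedFieldType) (p : nat).
Hypothesis charp : p \in [pchar K].

(** The proof argument keeps the characteristic inside the term, so that the ring morphism structure
    can be inferred for every [n]. *)
Definition frobn of (p \in [pchar K]) := fun (n : nat) (x : K) => x ^+ (p ^ n).
Local Notation fr := (frobn charp).

Lemma frobnS n x : fr n.+1 x = fr n x ^+ p.
Proof. by rewrite /frobn expnSr exprM. Qed.
Lemma frobnDn m n x : fr (m + n) x = fr m (fr n x).
Proof. by rewrite /frobn expnD mulnC exprM. Qed.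

Fact frobn_zmod n : zmod_morphism (fr n).
Proof.
elim: n => [|n IH] x y; first by rewrite /frobn expn0 !expr1.
by rewrite !frobnS IH -!(pFrobenius_autE charp) rmorphB.
Qed.
Fact frobn_monoid n : monoid_morphism (fr n).
Proof. by split=> [|x y]; rewrite /frobn ?expr1n // exprMn. Qed.
HB.instance Definition _ n := GRing.isZmodMorphism.Build K K (fr n) (frobn_zmod n).
HB.instance Definition _ n := GRing.isMonoidMorphism.Build K K (fr n) (frobn_monoid n).

End FrobeniusPowers.

Section TwistRecurrence.
Variables (K : closedFieldType) (p : nat).
Hypothesis algclos : is_alg_closure_Fp p K.
Let charp : p \in [pchar K]. Proof. by case: algclos. Qed.
Local Notation H := (hahn K).
Let p_gt1 : (1 < p)%N. Proof. exact/prime_gt1/(pcharf_prime charp). Qed.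
Let p_gt0 : (0 < p)%N. Proof. exact/ltnW. Qed.

Local Notation fr := (frobn charp).

Lemma frobn_fixM h k x : fr h x = x -> fr (h * k) x = x.
Proof. by move=> hx; elim: k => [|k IH]; rewrite ?muln0 ?expr1 // mulnS frobnDn IH. Qed.

(* The subring generated by an algebraic element over the prime field is finite, so two
   Frobenius iterates of [u] coincide. *)
Lemma frob_periodic (u : K) : exists2 h, (0 < h)%N & fr h u = u.
Proof.
have [P [P0 Pn /rootP Pu]] := algclos.2 u.
have Fermat (m : nat) : (m%:R : K) ^+ p = m%:R.
  by rewrite -(pFrobenius_autE charp) pFrobenius_aut_nat.
have prime_inv (m : nat) : (m%:R : K) != 0 -> exists m' : nat, m%:R * m'%:R = 1 :> K.
  move=> m0; exists (m ^ p.-2)%N; rewrite natrX -exprS.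
  have Ep : p.-2.+2 = p by case: (p) p_gt1 => [|[]].
  by apply: (mulfI m0); rewrite -exprS Ep mulr1 Fermat.
have nat_opp (m : nat) : exists m' : nat, - m%:R = m'%:R :> K.
  exists (m * p.-1)%N; apply/eqP; rewrite eq_sym -addr_eq0 -natrD -mulnSr prednK //.
  by rewrite natrM (pcharf0 charp) mulr0.
pose d := (size P).-1.
have sP : size P = d.+1 by rewrite prednK // size_poly_gt0.
have [l El] := Pn d.
have l0 : (l%:R : K) != 0 by rewrite -El -lead_coefE lead_coef_eq0.
have [l' ll'] := prime_inv l l0.
have [c cP] : exists c : nat -> nat, u ^+ d = \sum_(i < d) (c i)%:R * u ^+ i.
  have cex i : exists c : nat, - (l'%:R * P`_i) = c%:R.
    by have [m ->] := Pn i; rewrite -natrM; exact: nat_opp.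
  exists (fun i => projT1 (cid (cex i))).
  have : P.[u] * l'%:R = 0 by rewrite Pu mul0r.
  rewrite horner_coef sP big_ord_recr /= El mulrDl mulrAC ll' mul1r => /eqP.
  rewrite addrC addr_eq0 => /eqP ->; rewrite mulr_suml -sumrN; apply: eq_bigr => i _.
  by case: cid => m /= <-; ring.
(* The coefficients are images of natural numbers and may be reduced modulo [p], so the u^(p^n) take
   finitely many values. *)
have pow n : exists e : nat -> nat, u ^+ n = \sum_(i < d) (e i)%:R * u ^+ i.
  case: d cP {sP El} => [|d'] cP.
    have u0 : False by move: cP; rewrite expr0 big_ord0 => /eqP; rewrite oner_eq0.
    by [].
  elim: n => [|n [e eP]].
    exists (fun i => (i == 0)%N : nat); rewrite big_ord_recl big1 /= ?addr0 ?mulr1 //.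
    by move=> i _; rewrite mul0r.
  exists (fun i => ((if i is i'.+1 then e i' else 0) + e d' * c i)%N).
  rewrite exprSr eP mulr_suml big_ord_recr /= -mulrA -exprSr cP mulr_sumr.
  transitivity (\sum_(i < d'.+1) (if (i : nat) is i'.+1 then e i' else 0%N)%:R * u ^+ i
       + \sum_(i < d'.+1) (e d')%:R * ((c i)%:R * u ^+ i)).
    congr (_ + _); rewrite big_ord_recl mul0r add0r; apply: eq_bigr => i _.
    by rewrite -mulrA -exprSr.
  by rewrite -big_split; apply: eq_bigr => i _ /=; rewrite natrD natrM; ring.
have natmod (m : nat) : (m%:R : K) = (m %% p)%:R.
  by rewrite [in LHS](divn_eq m p) natrD natrM (pcharf0 charp) mulr0 add0r.
pose F n : {ffun 'I_d -> 'I_p} :=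
  [ffun i : 'I_d => Ordinal (ltn_pmod (projT1 (cid (pow (p ^ n)%N)) i) p_gt0)].
have FP n : u ^+ (p ^ n) = \sum_(i < d) (F n i : nat)%:R * u ^+ i.
  rewrite {1}(projT2 (cid (pow (p ^ n)%N))); apply: eq_bigr => i _.
  by rewrite ffunE /= -natmod.
have [i [j [ij Fij]]] := pigeonhole F.
exists (j - i)%N; first by rewrite subn_gt0.
apply: (fmorph_inj (fr i)).
rewrite -[LHS]/(fr i (fr (j - i) u)) -[RHS]/(fr i u) -frobnDn subnKC ?(ltnW ij) //.
by rewrite /frobn !FP Fij.
Qed.

Lemma frob_common_period (s : seq K) :
  exists2 h, (0 < h)%N & forall u, u \in s -> fr h u = u.
Proof.
elim: s => [|v s [h h0 hP]]; first by exists 1%N.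
have [k k0 kP] := frob_periodic v; exists (h * k)%N; first by rewrite muln_gt0 h0.
move=> u; rewrite inE => /predU1P [->|/hP /frobn_fixM -> //].
by rewrite mulnC frobn_fixM.
Qed.

(** The entries are roots of X^(p^h) - X, so only finitely many matrices are possible. *)
Lemma fixed_matrices_pigeonhole h n (C : nat -> 'M[K]_n) : (0 < h)%N ->
  (forall k, map_mx (fr h) (C k) = C k) -> exists i j, (i < j)%N /\ C i = C j.
Proof.
move=> h0 fixC; pose P : {poly K} := 'X^(p ^ h) - 'X.
have P0 : P != 0.
  have ph : (1 < p ^ h)%N by rewrite -[1%N](exp1n h) ltn_exp2r.
  by rewrite -size_poly_eq0 size_polyDl ?size_polyXn // size_polyN size_polyX.
have [rs rsP] := closed_field_poly_normal P.
have in_rs k i j : C k i j \in rs.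
  have : root P (C k i j).
    rewrite rootE !hornerE subr_eq0; apply/eqP.
    by have /matrixP /(_ i j) := fixC k; rewrite mxE.
  by rewrite rsP rootZ ?lead_coef_eq0 // root_prod_XsubC.
pose F k : {ffun 'I_n * 'I_n -> 'I_(size rs)} :=
  [ffun ij => Ordinal (introT idP (eq_ind_r is_true (in_rs k ij.1 ij.2) (index_mem
      (C k ij.1 ij.2) rs)))].
have [i [j [ij Fij]]] := pigeonhole F.
exists i, j; split=> //; apply/matrixP => s t.
have := congr1 (fun f : {ffun 'I_n * 'I_n -> 'I_(size rs)} => nth 0 rs (f (s, t))) Fij.
by rewrite !ffunE /= !nth_index.
Qed.

Section Recurrence.
Variables (I : finType) (W : I -> rat -> K).
Hypothesis stW : theta_stable p W.
Let n := #|I|.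
Let v (r : rat) : 'cV[K]_n := \col_i W (enum_val i) r.

Let Theta_ex b : exists Th : 'M[K]_n, (b < p)%N -> forall r, unit_frac r ->
  map_mx (fr 1) (v ((r - b%:R) / p%:R)) = Th *m v r.
Proof.
have [bp|_] := boolP (b < p)%N; last by exists 0.
have ex i := stW.2 i b bp.
exists (\matrix_(i, k) projT1 (cid (ex (enum_val i))) (enum_val k)) => _ r frr.
apply/colP => i; rewrite !mxE /frobn expn1.
have := projT2 (cid (ex (enum_val i))) r; rewrite /theta frr => ->.
rewrite (reindex (enum_val (A := predT))) /=; last first.
  by apply: onW_bij; exact: enum_val_bij.
by apply: eq_bigr => k _; rewrite !mxE.
Qed.
Let Th b := projT1 (cid (Theta_ex b)).
Let ThP b r : (b < p)%N -> unit_frac r ->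
  map_mx (fr 1) (v ((r - b%:R) / p%:R)) = Th b *m v r.
Proof. by rewrite /Th; case: cid => /= T TP bp; exact: TP. Qed.

(** Up to Frobenius twists, inserting [k] zeros multiplies [v] by a matrix, and a prefix [u]
    multiplies it by a matrix [T] that does not depend on [k]. All entries lie in the finite field
    fixed by [fr h], so two of the zero matrices agree, and one two-term recurrence serves all
    prefixes and all tails. *)
Lemma span_twist_recurrent f : span W f ->
  exists i j, (i < j)%N /\ forall u r, all (fun b => b < p)%N u -> unit_frac r ->
    f (prep p u (r / p%:R ^+ i)) ^+ (p ^ i) = f (prep p u (r / p%:R ^+ j)) ^+ (p ^ j).
Proof.
move=> [cf cfP].
have [h h0 hP] := frob_common_period
  ([seq cf i | i <- enum I] ++ [seq Th (b : 'I_p) ij.1 ij.2 | b <- enum 'I_p,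
      ij <- enum {: 'I_n * 'I_n}]).
have cf_fix i : fr h (cf i) = cf i.
  by apply: hP; rewrite mem_cat map_f // mem_enum.
have Th_fix b : (b < p)%N -> map_mx (fr h) (Th b) = Th b.
  move=> bp; apply/matrixP => i j; rewrite mxE; apply: hP.
  rewrite mem_cat; apply/orP; right.
  by apply: (@allpairs_f _ _ _ (fun (b : 'I_p) ij => Th b ij.1 ij.2) _ _ (Ordinal bp) (i, j));
     rewrite mem_enum.
have frS k m (M : 'M[K]_(m, 1)) : map_mx (fr k.+1) M = map_mx (fr k) (map_mx (fr 1) M).
  by apply/matrixP => i j; rewrite !mxE -frobnDn addn1.
have mxC k m1 m2 (M : 'M[K]_(m1, m2)) : map_mx (fr h) M = M ->
    map_mx (fr h) (map_mx (fr k) M) = map_mx (fr k) M.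
  move=> E; apply/matrixP => i j; have /matrixP /(_ i j) := E; rewrite !mxE => {2}<-.
  by rewrite -!frobnDn addnC.
have word u : all (fun b => b < p)%N u -> exists T : 'M[K]_n,
    map_mx (fr h) T = T /\ forall r, unit_frac r ->
      map_mx (fr (size u)) (v (prep p u r)) = T *m v r.
  elim: u => [_|b u IH /andP [bp up]].
    exists 1%:M; split=> [|r _]; first by rewrite map_mx1.
    by rewrite mul1mx; apply/matrixP => i j; rewrite !mxE /frobn expn0 expr1.
  have [T [Tfix TP]] := IH up.
  exists (map_mx (fr (size u)) (Th b) *m T); split=> [|r frr].
    by rewrite map_mxM Tfix mxC // Th_fix.
  by rewrite [size _]/= frS ThP ?unit_frac_prep // map_mxM TP // mulmxA.
have zeros k : exists C : 'M[K]_n, map_mx (fr h) C = C /\ forall r, unit_frac r ->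
      map_mx (fr k) (v (r / p%:R ^+ k)) = C *m v r.
  elim: k => [|k [C [Cfix CP]]].
    exists 1%:M; split=> [|r _]; first by rewrite map_mx1.
    by rewrite mul1mx expr0 divr1; apply/matrixP => i j; rewrite !mxE /frobn expn0 expr1.
  exists (map_mx (fr k) (Th 0%N) *m C); split=> [|r frr].
    by rewrite map_mxM Cfix mxC // Th_fix.
  have -> : r / p%:R ^+ k.+1 = (r / p%:R ^+ k - 0%:R) / p%:R.
    by rewrite subr0 exprSr invfM mulrA.
  by rewrite frS ThP ?unit_frac_zeros // map_mxM CP // mulmxA.
(* Only runs of length divisible by [h] are compared: the corresponding twists fix [T] and the
   coefficients [cf], and so pass through them. *)
pose C k := projT1 (cid (zeros (h * k)%N)).
have Cfix k : map_mx (fr h) (C k) = C k by rewrite /C; case: cid => ? [].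
have CP k r : unit_frac r -> map_mx (fr (h * k)) (v (r / p%:R ^+ (h * k))) = C k *m v r.
  by rewrite /C; case: cid => /= D [_ DP]; exact: DP.
have [i [j [ij Cij]]] := fixed_matrices_pigeonhole h0 Cfix.
exists (h * i)%N, (h * j)%N; split; first by rewrite ltn_pmul2l.
move=> u r up frr; have [T [Tfix TP]] := word u up.
have Tfixk k : map_mx (fr (h * k)) T = T.
  by apply/matrixP => s t; have /matrixP /(_ s t) := Tfix; rewrite !mxE; exact: frobn_fixM.
have key k : map_mx (fr (size u)) (map_mx (fr (h * k)) (v (prep p u (r / p%:R ^+ (h * k))))) =
    T *m C k *m v r.
  transitivity (map_mx (fr (h * k)) (map_mx (fr (size u)) (v (prep p u (r / p%:R ^+ (h * k)))))).
    by apply/matrixP => s t; rewrite !mxE -!frobnDn addnC.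
  by rewrite TP ?unit_frac_zeros // map_mxM Tfixk CP // mulmxA.
have vE : map_mx (fr (h * i)) (v (prep p u (r / p%:R ^+ (h * i)))) =
          map_mx (fr (h * j)) (v (prep p u (r / p%:R ^+ (h * j)))).
  apply/matrixP => s t; apply: (fmorph_inj (fr (size u))).
  have /matrixP /(_ s t) := etrans (key i) (etrans (congr1 (fun D =>
      T *m D *m v r) Cij) (esym (key j))).
  by rewrite mxE [RHS]mxE.
have fE k : f (prep p u (r / p%:R ^+ (h * k))) ^+ (p ^ (h * k)) =
    \sum_i cf i * (map_mx (fr (h * k)) (v (prep p u (r / p%:R ^+ (h * k))))) (enum_rank i) 0.
  rewrite cfP -/(fr (h * k) _) rmorph_sum; apply: eq_bigr => s _.
  rewrite -[LHS]/((cf s * W s _) ^+ _) exprMn -/(fr (h * k) (cf s)).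
  by rewrite (frobn_fixM _ (cf_fix s)) !mxE enum_rankK.
by rewrite !fE vE.
Qed.

End Recurrence.

Lemma finite_kernel_twist_recurrent (x : H) : finite_kernel p x -> twist_recurrent p x.
Proof.
move=> [a a0 [I [W [c [stW dW cW]]]]].
have aQ : (0 : rat) < a%:R by rewrite ltr0n.
have [M MP] := hahn_lower x.
pose b : int := `|Num.floor (M * a%:R)|%N.
have bP q : x q != 0 -> - b%:~R <= q * a%:R.
  move=> /MP; rewrite -(ler_pM2r aQ); apply: le_trans.
  apply: le_trans (floor_le _); rewrite -rmorphN ler_int /b; exact: lerNnormlW.
have fmE m z : unit_frac z -> fm x a m z = component a m x z by rewrite /fm /component => ->.
exists a, b, c; split=> //.
- move=> q xq; have [m [r [frr mr]]] := unit_frac_split (q * a%:R).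
  have cr : component a m x r != 0 by rewrite /component frr -mr mulfK // gt_eqF.
  have [d dP] := cW m.
  have [i Wi] : exists i, W i r != 0.
    apply: contrapT => no; move/negP: cr; apply; rewrite dP big1 // => i _.
    have [->|nz] := eqVneq (W i r) 0; first by rewrite mulr0.
    by case: no; exists i.
  have [bs ok rE] := digit_sum_le_digval p_gt1 frr (dW _ _ Wi).
  exists m, bs; split=> //; last by rewrite -rE -mr mulfK // gt_eqF.
  rewrite -(ler_int rat) rmorphN; apply: le_trans (bP q xq) _; rewrite mr.
  by case/andP: frr => _ r0; rewrite gerDl.
- move=> m _; have [i [j [ij E]]] := span_twist_recurrent stW (cW m).
  exists j; split; first exact: leq_ltn_trans ij.
  (* The equality of [span_twist_recurrent], written as a recurrence of order [j]; the order is
     positive because [i < j]. *)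
  exists (fun l => if l == j then 1 else if l == i then - 1 else 0); split.
    by exists j; rewrite eqxx oner_eq0.
  move=> j0 bs /andP [ok _] _ n.
  have oku : all (fun b => b < p)%N (take j0 bs).
    by apply/allP => y /mem_take; move/allP: ok => /[apply].
  have frs : unit_frac (- digval p (drop j0 bs) / p%:R ^+ n).
    apply: unit_frac_zeros => //; apply: unit_frac_digval => //.
    by apply/allP => y /mem_drop; move/allP: ok => /[apply].
  have argE l : fm x a m (twist_arg p j0 bs (n + l)) =
      component a m x (prep p (take j0 bs) (- digval p (drop j0 bs) / p%:R ^+ n / p%:R ^+ l)).
    rewrite twist_argE exprD invfM mulrA fmE // unit_frac_prep //.
    exact: unit_frac_zeros.
  rewrite (bigD1 (Ordinal (ltnSn j))) //= eqxx mul1r.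
  rewrite (bigD1 (Ordinal (ltn_trans ij (ltnSn j)))) /=; last by rewrite -val_eqE /= ltn_eqF.
  rewrite eqxx ltn_eqF // mulN1r !argE (E _ _ oku frs) addrA subrr add0r.
  apply: big1 => l /andP [lj li]; rewrite -!val_eqE /= in lj li.
  by rewrite (negPf lj) (negPf li) mul0r.
exists #|I|, (fun i => W (enum_val i)) => m _.
have [d dP] := cW m; exists (fun i => d (enum_val i)) => z [_ [z1 z0]].
rewrite fmE; last by rewrite /unit_frac z1 ltW.
rewrite dP (reindex (enum_val (A := predT))) //=.
by apply: onW_bij; exact: enum_val_bij.
Qed.

End TwistRecurrence.

(** * Series with finite kernels are integral *)

Lemma integral_sum (R S : comNzRingType) (f : {rmorphism R ->
    S}) (I : Type) (r : seq I) (P : pred I) (F : I -> S) :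
  (forall i, integralOver f (F i)) -> integralOver f (\sum_(i <- r | P i) F i).
Proof.
move=> h; elim/big_ind: _ => [|x y|//]; first exact: integral0.
exact: integral_add.
Qed.

Lemma integral_nth_root (R S : comNzRingType) (f : {rmorphism R -> S}) (u : S) (c : R) n :
  (0 < n)%N -> u ^+ n = f c -> integralOver f u.
Proof.
move=> n0 E; exists ('X^n - c%:P); first exact: monicXnsubC.
by rewrite rmorphB /= map_polyXn map_polyC rootE !hornerE E subrr.
Qed.

Lemma horner_map_monomials (R S : comNzRingType) (f : {rmorphism R -> S}) n
    (d : 'I_n -> R) (e : 'I_n -> nat) (y : S) :
  (map_poly f (\sum_(m < n) d m *: 'X^(e m))).[y] = \sum_(m < n) f (d m) * y ^+ e m.
Proof.
rewrite rmorph_sum horner_sum; apply: eq_bigr => m _ /=.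
by rewrite map_polyZ map_polyXn hornerZ hornerXn.
Qed.

(** * Integrality over the ring of Laurent series *)

Section LaurentRing.
Variable K : closedFieldType.
Local Notation H := (hahn K).

Definition laurent_pred : {pred H} := fun x => `[< laurent_at 1 x >].
Fact laurent_subring : subring_closed laurent_pred.
Proof.
split; first by apply/asboolP; exact: laurent_at1.
- by move=> x y /asboolP lx /asboolP ly; apply/asboolP; apply: laurent_atD =>
    //; exact: laurent_atN.
- by move=> x y /asboolP lx /asboolP ly; apply/asboolP; exact: laurent_atM.
Qed.
HB.instance Definition _ := GRing.isSubringClosed.Build H laurent_pred laurent_subring.

Record laurent_ring := LaurentRing { laurent_val :> H; _ : laurent_val \in laurent_pred }.
HB.instance Definition _ := [isSub for laurent_val].
HB.instance Definition _ := [Choice of laurent_ring by <:].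
HB.instance Definition _ := [SubChoice_isSubComNzRing of laurent_ring by <:].

Lemma laurent_ringP (x : laurent_ring) : laurent_at 1 x.
Proof. by case: x => x /= /asboolP. Qed.
Definition mklaurent (x : H) (lx : laurent_at 1 x) : laurent_ring := LaurentRing (introT
    (asboolP _) lx).
Definition laurent_hahn : {rmorphism laurent_ring -> H} := val.

(** Grouping exponents by residue modulo 1 writes [x] as the sum over [j < a] of t^(j/a) times a
    Laurent series [e j], and t^(1/a) is a root of X^a - t. *)
Lemma integral_laurent_at a (x : H) : (0 < a)%N -> laurent_at a x -> integralOver laurent_hahn x.
Proof.
move=> a0 [N NP]; have aQ : (a%:R : rat) != 0 by rewrite pnatr_eq0 -lt0n.
pose t : H := monomial a%:R^-1 1.
have int_t : integralOver laurent_hahn t.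
  have lt1 : laurent_at 1 (monomial 1 (1 : K)) by have := laurent_at_monomial 1 1 (1 : K);
      rewrite divr1.
  apply: (@integral_nth_root _ _ laurent_hahn t (mklaurent lt1) a a0).
  by rewrite monomial_exp expr1n -[_ *+ a]mulr_natr mulVf.
have tX j : t ^+ j = monomial (j%:R / a%:R) 1.
  by rewrite monomial_exp expr1n -[_ *+ j]mulr_natl.
pose e (j : nat) : H := restrict (fun q => q \is a Num.int) (monomial (- (j%:R / a%:R)) 1 * x).
have eE j q : e j q = if q \is a Num.int then x (q + j%:R / a%:R) else 0.
  by rewrite -[LHS]/(if q \is a Num.int then (monomial (- (j%:R / a%:R)) 1 * x) q else 0)
     monomialM mul1r opprK.
have le j : laurent_at 1 (e j).
  exists (- (`|N|%N%:Z + j%:Z)) => q; rewrite eE; case: ifP =>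
      [/intrP [m ->]|_]; last by rewrite eqxx.
  move=> /NP [n [Nn E]]; exists m; split; last by rewrite divr1.
  have E' : m * a%:Z + j%:Z = n.
    apply/eqP; rewrite -(eqr_int rat) rmorphD rmorphM /=; apply/eqP.
    by apply: (mulIf (invr_neq0 aQ)); rewrite -E mulrDl mulfK.
  have : (0 < a%:Z) by []. nia.
have -> : x = \sum_(j < a) t ^+ j * laurent_hahn (mklaurent (le j)).
  apply: hahnP => q; rewrite hahn_sumE.
  have [xq|xq] := eqVneq (x q) 0.
    rewrite xq big1 // => j _; rewrite tX monomialM mul1r -[laurent_hahn _]/(e j) eE subrK xq.
    by case: ifP.
  have [n [_ En]] := NP _ xq.
  have aZ : a%:Z != 0 by rewrite eqz_nat -lt0n.
  have jlt : (`|(n %% a%:Z)%Z|%N < a)%N.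
    by rewrite -ltz_nat gez0_abs ?modz_ge0 // ltz_pmod.
  rewrite (bigD1 (Ordinal jlt)) //= [X in _ + X]big1 ?addr0.
    rewrite tX -[hmul _ _ _]/((monomial _ 1 * e _) q) monomialM mul1r eE subrK ifT //.
    apply/intrP; exists (n %/ a%:Z)%Z; rewrite En natr_absz ger0_norm ?modz_ge0 //.
    rewrite {1}(divz_eq n a%:Z) rmorphD rmorphM /= mulrDl addrK mulfK //.
  move=> j nej; rewrite tX -[hmul _ _ _]/((monomial _ 1 * e _) q) monomialM mul1r eE subrK;
      case: ifP => // /intrP [m Em].
  case/eqP: nej; apply: val_inj => /=.
  have E' : n = m * a%:Z + (j : nat)%:Z.
    apply/eqP; rewrite -(eqr_int rat) rmorphD rmorphM /=; apply/eqP.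
    apply: (mulIf (invr_neq0 aQ)); rewrite -En mulrDl mulfK // -Em.
    by rewrite subrK.
  by rewrite E' modzMDl modz_small //; have := ltn_ord j; rewrite /= ltz_nat => ->.
apply: integral_sum => j; apply: integral_mul; last exact: integral_id.
elim: (j : nat) => [|k IH]; first by rewrite expr0; exact: integral1.
by rewrite exprS; exact: integral_mul.
Qed.

Lemma integral_laurentP (x : H) : integralOver laurent_hahn x -> integral_over_laurent x.
Proof.
move=> [P monP /rootP rP]; pose n := (size P).-1.
have sP : size P = n.+1 by rewrite prednK // size_poly_gt0 monic_neq0.
exists n, (fun j => P`_j : H); split.
  move=> j; have [N NP] := laurent_ringP P`_j; exists N => q /NP [m [Nm ->]].
  by exists m; rewrite divr1.
move=> k; have := congr1 (fun y : H => y k) rP.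
rewrite (@horner_coef_wide _ n.+1); last by rewrite -sP size_poly.
rewrite hahn_sumE hahn0E big_ord_recr => E; rewrite -[RHS]E addrC; congr (_ + _).
  by apply: eq_bigr => j _; rewrite [in RHS]coef_map -hahnXE.
have : laurent_hahn P`_n = 1 by rewrite -[n]/(size P).-1 -lead_coefE (monicP monP) rmorph1.
by move=> lP; rewrite [in RHS]coef_map [X in X * _]lP mul1r hahnXE.
Qed.

End LaurentRing.

(** * Semilinear systems over the Puiseux field *)

Section Systems.
Variables (K : closedFieldType) (p : nat).
Hypothesis charp : p \in [pchar K].
Local Notation H := (hahn K).
Local Notation E := (puiseux K).
Let p_gt1 : (1 < p)%N. Proof. exact/prime_gt1/(pcharf_prime charp). Qed.
Let p_gt0 : (0 < p)%N. Proof. exact/ltnW. Qed.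

Lemma integral_puis (x : H) : integralOver (puiseux_hahn K) x -> integralOver (laurent_hahn K) x.
Proof.
move=> [P monP rP]; apply: (@integral_root_monic _ _ (laurent_hahn K) x (map_poly
    (puiseux_hahn K) P)) => //.
  by rewrite map_monic.
apply/integral_poly => i; rewrite coef_map.
have [a [a0 la]] := puisP P`_i; exact: integral_laurent_at a0 la.
Qed.

(** All powers [w i ^+ (p ^ m)] are combinations of the same [n] series over the Puiseux field, so
    [n + 1] of them are dependent. The resulting polynomial [Q] is nonzero because the exponents p^m
    are distinct. *)
Lemma integral_frobenius_system (I : finType) (w : I -> H) (A : I -> I -> E) :
  (forall i, w i ^+ p = \sum_k puiseux_hahn K (A i k) * w k) ->
      forall i, integralOver (puiseux_hahn K) (w i).
Proof.
move=> wA i; pose n := #|I|.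
have [B BP] : exists B : nat -> I ->
    E, forall m, w i ^+ (p ^ m) = \sum_k puiseux_hahn K (B m k) * w k.
  have ex m : exists B : I -> E, w i ^+ (p ^ m) = \sum_k puiseux_hahn K (B k) * w k.
    elim: m => [|m [B BP]].
      exists (fun k => (k == i)%:R); rewrite expn0 expr1 (bigD1 i) //= big1.
        by rewrite eqxx mul1r addr0.
      by move=> k /negPf ->; rewrite mul0r.
    exists (fun l => \sum_k B k ^+ p * A k l).
    rewrite expnSr exprM BP -[X in X ^+ p]/(\sum_(k <- index_enum I) _).
    have := frob_iter_sum charp (index_enum I) (fun k => puiseux_hahn K (B k) * w k) 1.
    rewrite expn1 => ->; transitivity (\sum_k \sum_l puiseux_hahn K (B k ^+ p * A k l) * w l).
      apply: eq_bigr => k _; rewrite exprMn wA mulr_sumr; apply: eq_bigr => l _.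
      by rewrite rmorphM rmorphXn mulrA.
    rewrite exchange_big; apply: eq_bigr => l _.
    by rewrite raddf_sum mulr_suml.
  by exists (fun m => projT1 (cid (ex m))) => m; case: cid.
pose c : 'M[E]_(n.+1, n) := \matrix_(m, k) B m (enum_val k).
have /rowV0Pn [d /sub_kermxP dc d0] : kermx c != 0.
  by rewrite -mxrank_eq0 mxrank_ker subn_eq0 -ltnNge ltnS rank_leq_col.
have dw : \sum_(m < n.+1) puiseux_hahn K (d 0 m) * w i ^+ (p ^ m) = 0.
  transitivity (\sum_k puiseux_hahn K ((d *m c) 0 (enum_rank k)) * w k); last first.
    by rewrite dc big1 // => k _; rewrite mxE rmorph0 mul0r.
  under eq_bigr => m _ do rewrite BP mulr_sumr.
  rewrite exchange_big; apply: eq_bigr => k _.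
  rewrite mxE raddf_sum mulr_suml; apply: eq_bigr => m _.
  by rewrite [c _ _]mxE enum_rankK mulrA -rmorphM.
pose Q : {poly E} := \sum_(m < n.+1) d 0 m *: 'X^(p ^ m).
have Q0 : Q != 0.
  have /rV0Pn [m dm] := d0; apply/eqP => Qz; move/negP: dm; apply.
  have : Q`_(p ^ m) = 0 by rewrite Qz coef0.
  rewrite coef_sum (bigD1 m) //= coefZ coefXn eqxx mulr1 big1 ?addr0; first by move=> ->.
  move=> l lm; rewrite coefZ coefXn eqn_exp2l // val_eqE eq_sym (negPf lm).
  by rewrite mulr0.
have rQ : root (map_poly (puiseux_hahn K) Q) (w i).
  by apply/rootP; rewrite -[RHS]dw horner_map_monomials.
exists ((lead_coef Q)^-1 *: Q).
  by rewrite monicE lead_coefZ mulVf // lead_coef_eq0.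
apply/rootP; have -> : map_poly (puiseux_hahn K) ((lead_coef Q)^-1 *: Q) =
    puiseux_hahn K (lead_coef Q)^-1 *: map_poly (puiseux_hahn K) Q.
  by apply/polyP => k; rewrite coefZ !coef_map coefZ; exact: rmorphM.
by rewrite hornerZ (rootP rQ) mulr0.
Qed.

(** An exponent splits in only one way into an integer over [a] and a part in (-1, 0] over [a], so
    the convolution has a single term. *)
Lemma mul_unit_frac a (h y : H) (m : int) r : (0 < a)%N -> laurent_at a h ->
  (forall q, y q != 0 -> unit_frac (q * a%:R)) -> unit_frac r ->
  (h * y) ((m%:~R + r) / a%:R) = h (m%:~R / a%:R) * y (r / a%:R).
Proof.
move=> a0 [N NP] yP frr; have aQ : (a%:R : rat) != 0 by rewrite pnatr_eq0 -lt0n.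
rewrite hahnME (@hmul_seq _ _ _ _ [:: m%:~R / a%:R]) ?big_seq1 //.
  by congr (_ * y _); rewrite -mulrBl addrC addKr.
move=> i /NP [n [_ ->]] /yP; rewrite -mulrBl divfK // inE => fr'.
have : m - n = 0 by apply: unit_frac_int frr fr' _; rewrite rmorphB /=; ring.
by move/eqP; rewrite subr_eq0 => /eqP ->.
Qed.

Lemma system_integral a (x : H) (I : finType) (V : I -> rat -> K) : (0 < a)%N ->
  theta_stable p V -> (forall i, well_ordered (hsupp (V i))) ->
  (forall m, span V (component a m x)) -> integral_over_laurent x.
Proof.
move=> a0 [frV stV] woV cV.
have aQ : (0 : rat) < a%:R by rewrite ltr0n.
have aQ0 : (a%:R : rat) != 0 by rewrite gt_eqF.
have wo_w i : well_ordered (hsupp (fun q => V i (q * a%:R))).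
  move=> B sB [b Bb].
  have [||m [q Bq <-] mP] := woV i [set q * a%:R | q in B].
  - by move=> _ [q /sB h <-].
  - by exists (b * a%:R), b.
  exists q => // b' Bb'; have : q * a%:R <= b' * a%:R by apply: mP; exists b'.
  by rewrite ler_pM2r.
pose w i : H := mkhahn (wo_w i).
have wP i q : w i q != 0 -> unit_frac (q * a%:R) by exact: frV.
have Th_ex b i : exists c : I -> K, (b < p)%N -> forall r, theta p b (V i) r = \sum_k c k * V k r.
  have [bp|_] := boolP (b < p)%N; last by exists (fun=> 0).
  by have [c cP] := stV i b bp; exists c.
pose Th b i := projT1 (cid (Th_ex b i)).
have ThP b i r : (b < p)%N -> theta p b (V i) r = \sum_k Th b i k * V k r.
  by move=> bp; rewrite /Th; case: cid => /= c; exact.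
(* The power series will start at the exponent [-(p - 1) / a], so index [n] stands for the digit
   [p - 1 - n]. *)
pose g i k : nat -> K := fun n => if (n < p)%N then Th (p - n.+1)%N i k else 0.
(* The exponent [-b/a] carries the coefficient [Th b i k]. *)
pose Ah i k : H := monomial ((- (p.-1)%:Z)%:~R / a%:R) 1 * ps a (g i k).
have lA i k : laurent_at a (Ah i k).
  by apply: laurent_atM; [exact: laurent_at_monomial | exact: laurent_at_ps].
have AhE i k (m : int) : Ah i k (m%:~R / a%:R) =
    if (m <= 0) && (- m < p%:Z) then Th `|m|%N i k else 0.
  rewrite /Ah monomialM mul1r -mulrBl -rmorphB /=.
  have [lt|ge] := ltP (m - - p.-1%:Z) 0.
    rewrite ifF; last by lia.
    apply/eqP/negPn/negP => /(ps_neq0 a0) [n /(mulIf (invr_neq0 aQ0)) E _].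
    by move: lt; rewrite -(ltr_int rat) E -[n%:R]/(n%:~R) ltr_int.
  have [N EN] : exists N : nat, m - - p.-1%:Z = N%:Z by exists (absz (m + p.-1%:Z)%R); lia.
  rewrite EN -[N%:~R]/(N%:R) psE // /g.
  case: ifP => h; case: ifP => h' //; [|lia|lia].
  by congr (Th _ i k); lia.
pose A i k : E := mkpuis (ex_intro _ a (conj a0 (lA i k)) : is_puiseux (Ah i k)).
have wA i : w i ^+ p = \sum_k puiseux_hahn K (A i k) * w k.
  apply: hahnP => q; rewrite hahn_sumE (hahn_frobE charp).
  have [m [r [frr mr]]] := unit_frac_split (q * a%:R).
  have -> : q = (m%:~R + r) / a%:R by rewrite -mr mulfK.
  under eq_bigr => k _ do rewrite (mul_unit_frac m a0 (lA i k) (@wP k) frr) AhE.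
  rewrite /= mulrAC divfK //.
  have [/andP [m0 mp]|h] := boolP ((m <= 0) && (- m < p%:Z)).
    have bp : (`|m| < p)%N by lia.
    have := ThP _ i r bp; rewrite /theta frr => E.
    transitivity (V i ((r - `|m|%N%:R) / p%:R) ^+ p).
      congr (V i (_ / _) ^+ p); rewrite natr_absz ler0_norm // rmorphN /=; ring.
    rewrite E; apply: eq_bigr => k _; by rewrite divfK.
  (* For the other values of [m], the point [(m + r) / p] is outside (-1, 0], where [V i]
     vanishes. *)
  rewrite [RHS]big1; last by move=> k _; rewrite mul0r.
  apply/eqP; rewrite expf_eq0 p_gt0 /=; apply/negPn/negP => /frV /andP [].
  rewrite ltr_pdivlMr ?ltr0n // ler_pdivrMr ?ltr0n // mul0r mulN1r => h1 h2.
  case/andP: frr => r1 r0; move: h; apply/negP; rewrite negbK.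
  have : m%:~R < 1 :> rat by lra.
  move/int_lt1 => -> /=.
  have : (- p%:Z)%:~R < m%:~R :> rat by rewrite rmorphN /=; lra.
  by rewrite ltr_int; lia.
have int_w := integral_frobenius_system wA.
have [M MP] := hahn_lower x.
pose B := `|Num.floor (M * a%:R)|%N.+1.
have low m r : m <= - B%:Z -> component a m x r = 0.
  move=> mB; rewrite /component; case: ifP => // /andP [_ r0].
  apply/eqP/negPn/negP => /MP; rewrite ler_pdivlMr // => h.
  have h1 := le_trans (floor_le _) h.
  have : Num.floor (M * a%:R) <= m.
    by rewrite -(ler_int rat) (le_trans h1) // gerDl.
  by move: mB; rewrite /B; lia.
pose co m := projT1 (cid (cV m)).
have coP m r : component a m x r = \sum_i co m i * V i r by rewrite /co; case: cid.
(* [h i] collects the [i]-th coordinates of all components of [x]; starting at [- B] loses nothing,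
   by [low]. *)
pose h i : H := monomial ((- B%:Z)%:~R / a%:R) 1 * ps a (fun n => co (n%:Z - B%:Z) i).
have lh i : laurent_at a (h i).
  by apply: laurent_atM; [exact: laurent_at_monomial | exact: laurent_at_ps].
have xE : x = \sum_i h i * w i.
  apply: hahnP => q; rewrite hahn_sumE.
  have [m [r [frr mr]]] := unit_frac_split (q * a%:R).
  have -> : q = (m%:~R + r) / a%:R by rewrite -mr mulfK.
  under eq_bigr => k _ do rewrite (mul_unit_frac m a0 (lh k) (@wP k) frr).
  have -> : x ((m%:~R + r) / a%:R) = component a m x r by rewrite /component frr.
  have hE k : h k (m%:~R / a%:R) = if - B%:Z <= m then co m k else 0.
    rewrite /h monomialM mul1r -mulrBl -rmorphB /=; case: ifP => c.
      have [N EN] : exists N : nat, m - - B%:Z = N%:Z by exists (absz (m + B%:Z)%R); lia.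
      rewrite EN -[N%:~R]/(N%:R) psE //; congr (co _ k); lia.
    apply/eqP/negPn/negP => /(ps_neq0 a0) [n /(mulIf (invr_neq0 aQ0)) E _].
    have : (0 : rat) <= (m - - B%:Z)%:~R by rewrite E ler0n.
    by rewrite ler0z; lia.
  under eq_bigr => k _ do rewrite hE.
  have [c|c] := boolP (- B%:Z <= m).
    by rewrite coP; apply: eq_bigr => k _; rewrite /= divfK.
  rewrite low; last by lia.
  by rewrite big1 // => k _; rewrite mul0r.
apply: integral_laurentP; rewrite xE; apply: integral_sum => i.
apply: integral_mul; first exact: (integral_laurent_at a0 (lh i)).
exact: integral_puis.
Qed.

End Systems.

(** * Kernels of twist-recurrent series *)

(** At most [c] nonzero digits separate at most [c + 1] runs of zeros, and the length forces one of
    them to reach [k]. The induction cuts the word after a nonzero digit among its first [k]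
    letters. *)
Lemma long_word_zero_run k c (u : seq nat) : (sumn u <= c)%N ->
  (c.+1 * k.+1 <= size u)%N -> exists u1 u2, u = u1 ++ nseq k 0%N ++ u2.
Proof.
elim: c u => [|c IH] u su szu;
  have ku : (k <= size u)%N by apply: leq_trans (leq_trans (leqnSn k) (leq_pmull _ _)) szu.
  exists [::], (drop k u); rewrite /= -[LHS](cat_take_drop k); congr (_ ++ _).
  have /all_pred1P -> : all (pred1 0%N) (take k u).
    apply/allP => b /mem_take bu /=.
    move: su; case/splitPr: bu => w1 w2; rewrite sumn_cat /=; lia.
  by rewrite size_takel.
have [Z|] := boolP (all (pred1 0%N) (take k u)).
  exists [::], (drop k u); rewrite /= -[LHS](cat_take_drop k); congr (_ ++ _).
  have /all_pred1P -> := Z.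
  by rewrite size_takel.
rewrite -has_predC => nz.
have [b bu b0] : exists2 b : nat, b \in take k u & (0 < b)%N.
  by case/hasP: nz => b bu b0; exists b; rewrite ?lt0n.
have szk : size (take k u) = k by rewrite size_takel.
have [w1 [w2 Ek]] : exists w1 w2 : seq nat, take k u = w1 ++ b :: w2.
  by case/splitPr: bu => w1 w2; exists w1, w2.
have Eu : u = w1 ++ b :: (w2 ++ drop k u) by rewrite -{1}(cat_take_drop k u) Ek -catA.
have sw : (size w1 + (size w2).+1 = k)%N by rewrite -szk Ek size_cat.
have [||u1 [u2 E]] := IH (w2 ++ drop k u).
- have := congr1 sumn Eu; rewrite sumn_cat /=; lia.
- by have := congr1 size Eu; rewrite size_cat /=; nia.
by exists (w1 ++ b :: u1), u2; rewrite Eu E -catA.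
Qed.

Lemma well_ordered_preim (g : rat -> rat) (A : set rat) :
  (forall r s, g r <= g s -> r <= s) -> well_ordered A -> well_ordered [set r | A (g r)].
Proof.
move=> gmono woA B sB [b Bb].
have [||m [r Br <-] mP] := woA [set g r | r in B].
- by move=> _ [r /sB h <-].
- by exists (g b), b.
by exists r => // s Bs; apply: gmono; apply: mP; exists s.
Qed.

Section FiniteBasis.
Variable F : fieldType.
Local Open Scope lfun_scope.

(** The list is chosen to span a space of maximal dimension, which one more vector cannot
    enlarge. *)
Lemma finite_basis (I : Type) (P : I -> Prop) n (cf : I -> 'rV[F]_n) :
  exists ms : seq I, (forall m, List.In m ms -> P m) /\
    forall m, P m -> cf m \in <<[seq cf m | m <- ms]>>%VS.
Proof.
pose Q d := exists2 ms : seq I, (forall m, List.In m ms -> P m) &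
  \dim <<[seq cf m | m <- ms]>>%VS = d.
have exQ : exists d, `[< Q d >].
  by exists (\dim <<[seq cf m | m <- [::]]>>%VS); apply/asboolP; exists [::].
have ubQ d : `[< Q d >] -> (d <= \dim {:'rV[F]_n})%N.
  by move=> /asboolP [ms _ <-]; apply/dimvS/subvf.
case: (ex_maxnP exQ ubQ) => d /asboolP [ms msP dE] maxd.
exists ms; split=> // m Pm.
have : (\dim <<[seq cf m | m <- m :: ms]>>%VS <= d)%N.
  by apply: maxd; apply/asboolP; exists (m :: ms) => // m' [<-//|/msP].
rewrite -dE /= span_cons => le.
have sub : (<<[seq cf m | m <- ms]>> <= <[cf m]> + <<[seq cf m | m <- ms]>>)%VS by apply: addvSr.
have /eqP -> : <<[seq cf m | m <- ms]>>%VS == (<[cf m]> + <<[seq cf m | m <- ms]>>)%VS.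
  by rewrite eqEdim sub le.
by apply: (subvP (addvSl _ _)); apply: memv_line.
Qed.

End FiniteBasis.

Section Digits.
Variable p : nat.
Hypothesis p_gt1 : (1 < p)%N.
Let p0 : (0 : rat) < p%:R. Proof. by rewrite ltr0n ltnW. Qed.

Lemma digval_eq0 bs : sumn bs = 0%N -> digval p bs = 0.
Proof.
elim: bs => [|b bs IH] /=; first by rewrite digval_nil.
by move/eqP; rewrite addn_eq0 => /andP [/eqP -> /eqP /IH E]; rewrite digval_cons E addr0 mul0r.
Qed.

Lemma digval_gt0 bs : (0 < sumn bs)%N -> 0 < digval p bs.
Proof.
elim: bs => //= b bs IH; rewrite addn_gt0 digval_cons => h; apply: divr_gt0 => //.
have v0 := digval_ge0 p bs; have b0 : (0 : rat) <= b%:R by rewrite ler0n.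
case/orP: h => [b1|/IH h]; last by lra.
have : (0 : rat) < b%:R by rewrite ltr0n.
by lra.
Qed.

Lemma prep_zeros n r : prep p (nseq n 0%N) r = r / p%:R ^+ n.
Proof.
elim: n => [|n IH]; first by rewrite expr0 divr1.
by rewrite [LHS]/= IH subr0 exprSr invfM mulrA.
Qed.

Lemma prep_cat u v r : prep p (u ++ v) r = prep p u (prep p v r).
Proof. by rewrite /prep foldr_cat. Qed.

Lemma prep_mono u r s : prep p u r <= prep p u s -> r <= s.
Proof.
by elim: u => //= b u IH; rewrite ler_pM2r ?invr_gt0 // lerD2r.
Qed.

(** A finite digit string has value strictly below 1, so expansions are unique and the digits of [u]
    can be stripped one by one. *)
Lemma unprep u r c bs : all (fun b => b < p)%N u -> unit_frac r -> digits_ok p c bs ->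
  prep p u r = - digval p bs -> exists bs', [/\ all (fun b => b < p)%N bs',
    r = - digval p bs' & (sumn u + sumn bs' <= c)%N].
Proof.
elim: u c bs => [|b u IH] c bs /=.
  by move=> _ frr /andP [ok sb] ->; exists bs.
move=> /andP [bp up] frr /andP [ok sb] E.
have [b' [bs1 [b'p ok1 s1 v1]]] : exists b' bs1, [/\ (b' < p)%N, all (fun b => b < p)%N bs1,
    sumn bs = (b' + sumn bs1)%N & digval p bs = digval p (b' :: bs1)].
  case: bs ok {sb E} => [_|b1 bs1 /andP [bp1 ok1]]; last by exists b1, bs1.
  by exists 0%N, [::]; split=> //; [exact: ltnW | rewrite digval_cons digval_nil addr0 mul0r].
have fr' := unit_frac_prep up frr.
have v0 := digval_ge0 p bs1; have v1' := digval_lt1 p_gt1 ok1.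
have E' : prep p u r - b%:R = - (b'%:R + digval p bs1).
  by move: E; rewrite v1 digval_cons -mulNr => /(mulIf (invr_neq0 (lt0r_neq0 p0))).
have bb : b = b'.
  have : b%:Z - b'%:Z = 0.
    apply: (@unit_frac_int _ (- digval p bs1) (prep p u r)) => //.
      by rewrite /unit_frac ltrN2 v1' oppr_le0.
    by rewrite rmorphB /=; lra.
  lia.
have [||bs' [ok' rE s']] := IH (sumn bs1) bs1 up frr _ _.
- by rewrite /digits_ok ok1 leqnn.
- by move: E'; rewrite bb; lra.
by exists bs'; split=> //; lia.
Qed.

End Digits.

Section WordKernels.
Variables (K : closedFieldType) (p : nat).
Hypothesis charp : p \in [pchar K].
Local Notation H := (hahn K).
Let p_gt1 : (1 < p)%N. Proof. exact/prime_gt1/(pcharf_prime charp). Qed.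
Let p_gt0 : (0 < p)%N. Proof. exact/ltnW. Qed.
Local Notation digits := (all (fun b : nat => (b < p)%N)).

Definition theta_word (u : seq nat) (f : rat -> K) (r : rat) : K :=
  if unit_frac r then f (prep p u r) ^+ (p ^ size u) else 0.

(** [theta b] acts on the argument before [prep p u] does, so the new digit comes after those of
    [u]. *)
Lemma theta_theta_word b u f r : (b < p)%N ->
  theta p b (theta_word u f) r = theta_word (rcons u b) f r.
Proof.
move=> bp; rewrite /theta /theta_word; case: ifP => // frr.
by rewrite unit_frac_div // -cats1 prep_cat size_cat addn1 expnSr exprM.
Qed.

Lemma digits_zeros n : digits (nseq n 0%N).
Proof. by apply/allP => b /nseqP [-> _]. Qed.

Section Reduction.
Variables (f : rat -> K) (c k : nat) (d : nat -> K).
Hypothesis f_digits :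
  forall r, f r != 0 -> exists2 bs, digits_ok p c bs & r = - digval p bs.
Hypothesis d_nz : exists l, (l <= k)%N /\ d l != 0.
Hypothesis f_rec : forall u r, digits u -> unit_frac r ->
  \sum_(l < k.+1) d l * f (prep p u (r / p%:R ^+ l)) ^+ (p ^ l) = 0.

(* The recurrence expresses a word with a long run of zeros through shorter words;
   a long word without such a run has digit sum exceeding [c]. *)
Lemma theta_word_span (L : nat) (I : finType) (V : I -> rat -> K) :
  (c.+1 * k.+1 <= L)%N ->
  (forall u, digits u -> (size u < L)%N -> span V (theta_word u f)) ->
  forall u, digits u -> span V (theta_word u f).
Proof.
move=> Lc short.
have exl : exists l, (l <= k)%N && (d l != 0).
  by have [l [lk dl]] := d_nz; exists l; rewrite lk.
have ubl l : (l <= k)%N && (d l != 0) -> (l <= k)%N by case/andP.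
(* [k0] is the last index with a nonzero coefficient; the recurrence is solved for its term. *)
case: (ex_maxnP exl ubl) => k0 /andP [k0k dk0] maxk0.
suff gen n u : (size u < n)%N -> digits u -> span V (theta_word u f).
  by move=> u; apply: (gen (size u).+1).
elim: n u => // n IH u un du.
have [|Lu] := ltnP (size u) L; first exact: short.
have [cu|uc] := ltnP c (sumn u).
  apply: span0 => r; rewrite /theta_word; case: ifP => // frr.
  apply/eqP; rewrite expf_eq0 expn_gt0 p_gt0 /=; apply/negPn/negP => /f_digits [bs ok E].
  by have [bs' [_ _ s]] := unprep p_gt1 du frr ok E; lia.
have ku : (c.+1 * k0.+1 <= size u)%N.
  by apply: leq_trans Lu; apply: leq_trans Lc; rewrite leq_mul2l ltnS k0k orbT.
have [u1 [u2 E]] := long_word_zero_run uc ku.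
move: du un; rewrite E !all_cat !size_cat size_nseq => /and3P [d1 _ d2] un.
(* The letters outside the run of zeros contribute [N] Frobenius twists, which also act on the
   coefficients of the recurrence. *)
pose N := (size u1 + size u2)%N.
have sp (l : 'I_k0) : span V (theta_word (u1 ++ nseq l 0%N ++ u2) f).
  apply: IH; first by rewrite !size_cat size_nseq; have := ltn_ord l; lia.
  by rewrite !all_cat d1 d2 digits_zeros.
have := spanN (span_sum (index_enum 'I_k0) (fun l : 'I_k0 => (d l / d k0) ^+ (p ^ N)) sp).
apply: span_ext => r; rewrite /theta_word; case: ifP => frr; last first.
  by rewrite big1 ?oppr0 // => l _; rewrite mulr0.
have term l : f (prep p (u1 ++ nseq l 0%N ++ u2) r) ^+ (p ^ size (u1 ++ nseq l 0%N ++ u2)) =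
    frobn charp N (f (prep p u1 (prep p u2 r / p%:R ^+ l)) ^+ (p ^ l)).
  rewrite !prep_cat prep_zeros /frobn -exprM -expnD !size_cat size_nseq.
  by congr (_ ^+ (p ^ _)); rewrite /N; lia.
have := f_rec d1 (unit_frac_prep d2 frr).
rewrite -(big_mkord xpredT (fun l => d l * f (prep p u1 (prep p u2 r / p%:R ^+ l)) ^+ (p ^ l))).
rewrite (big_cat_nat (n := k0.+1)) //= [X in _ + X]big_nat_cond [X in _ + X]big1; last first.
  move=> l /andP [/andP [k0l lk] _]; suff -> : d l = 0 by rewrite mul0r.
  apply/eqP/negPn/negP => dl; have := maxk0 l; rewrite dl andbT -ltnS lk.
  by move/(_ isT); lia.
rewrite addr0 big_mkord big_ord_recr /= => /eqP; rewrite addrC addr_eq0 => /eqP E0.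
rewrite term.
have -> : f (prep p u1 (prep p u2 r / p%:R ^+ k0)) ^+ (p ^ k0) =
    - \sum_(l < k0) (d l / d k0) * f (prep p u1 (prep p u2 r / p%:R ^+ l)) ^+ (p ^ l).
  apply: (mulfI dk0); rewrite E0 mulrN mulr_sumr; congr (- _); apply: eq_bigr => l _.
  by rewrite mulrA mulrCA divff // mulr1.
rewrite raddfN; congr (- _); rewrite raddf_sum; apply: eq_bigr => l _.
by rewrite term -[RHS]/(frobn charp N _) rmorphM.
Qed.

End Reduction.

(** The definition only tests digit strings of positive sum. If some term is nonzero, then [r] is
    itself a finite digit string, and the value 0 of [f] at 0 forces the digits of [u] and [r] to
    have positive sum; if none is, the identity is trivial. *)
Lemma twist_recurrent_prep (F : rat -> K) c k d (f : rat -> K) :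
  (forall r, f r = if unit_frac r && (r != 0) then F r else 0) ->
  (forall r, f r != 0 -> exists2 bs, digits_ok p c bs & r = - digval p bs) ->
  (forall j0 bs, digits_ok p c bs -> (0 < sumn bs)%N -> forall n,
     \sum_(l < k.+1) d l * F (twist_arg p j0 bs (n + l)) ^+ (p ^ l) = 0) ->
  forall u r, digits u -> unit_frac r ->
  \sum_(l < k.+1) d l * f (prep p u (r / p%:R ^+ l)) ^+ (p ^ l) = 0.
Proof.
move=> fE f_digits Frec u r du frr.
have [[l fl]|no] := pselect (exists l, f (prep p u (r / p%:R ^+ l)) != 0); last first.
  apply: big1 => l _; apply/eqP; rewrite mulf_eq0 expf_eq0 expn_gt0 p_gt0 /=.
  by apply/orP; right; apply/negPn/negP => h; apply: no; exists l.
have [bs ok E] := f_digits _ fl.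
have [bs' [ok' rE s']] : exists bs', [/\ digits bs', r =
    - digval p bs' & (sumn u + sumn bs' <= c)%N].
  rewrite -prep_zeros -prep_cat in E.
  have [|bs' [ok' rE s']] := unprep p_gt1 _ frr ok E.
    by rewrite all_cat du digits_zeros.
  exists bs'; split=> //; move: s'; rewrite sumn_cat; lia.
have argE l' : prep p u (r / p%:R ^+ l') = - digval p (u ++ nseq l' 0%N ++ bs').
  by rewrite -!prep_digval prep_zeros rE.
have sum0 l' : sumn (u ++ nseq l' 0%N ++ bs') = sumn (u ++ bs').
  by rewrite !sumn_cat sumn_nseq mul0n.
have pos : (0 < sumn (u ++ bs'))%N.
  rewrite lt0n; apply/eqP => z; move: fl.
  have z' : digval p (u ++ nseq l 0%N ++ bs') = 0 by apply: digval_eq0; rewrite sum0.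
  have f0 : f 0 = 0 by rewrite fE.
  by rewrite argE z' oppr0 f0 eqxx.
have ok2 : digits_ok p c (u ++ bs').
  by rewrite /digits_ok all_cat du ok' sumn_cat.
rewrite -[RHS](Frec (size u) _ ok2 pos 0%N); apply: eq_bigr => l' _.
rewrite add0n twist_argE take_size_cat // drop_size_cat // -rE fE.
rewrite unit_frac_prep ?unit_frac_zeros // argE oppr_eq0 gt_eqF //.
by apply: digval_gt0 => //; rewrite sum0.
Qed.

(** Bounded sequences over ['I_p] form a finite type, as the index of a span must. *)
Lemma lift_word L u : digits u -> (size u < L)%N ->
  exists w : L.-bseq 'I_p, map val w = u.
Proof.
move=> du uL; pose w := pmap (insub : nat -> option 'I_p) u.
have wu : map val w = u.
  rewrite /w; elim: u du {uL w} => //= b u IH /andP [bp du].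
  by rewrite insubT /= IH.
have sw : (size w <= L)%N by rewrite -(size_map val) wu ltnW.
by exists (Bseq sw).
Qed.

Lemma twist_recurrent_integral (x : H) : twist_recurrent p x -> integral_over_laurent x.
Proof.
move=> [a [b [c [a0 suppx rec [n [g gP]]]]]].
have aQ : (a%:R : rat) != 0 by rewrite pnatr_eq0 -lt0n.
(* The point 0 lies outside [T_set], where nothing is known from the recurrences. It is removed here
   and restored by the generator [None] of [V]. *)
pose f (m : int) r := if unit_frac r && (r != 0) then fm x a m r else 0.
have supp m r : unit_frac r -> fm x a m r != 0 ->
    - b <= m /\ exists2 bs, digits_ok p c bs & r = - digval p bs.
  move=> frr /suppx [N [bs [Nb ok /(mulIf (invr_neq0 aQ)) E]]].
  have v0 := digval_ge0 p bs; have v1 : digval p bs < 1 by apply: digval_lt1 => //; case/andP: ok.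
  have /eqP : N - m = 0.
    apply: (@unit_frac_int _ (- digval p bs) r) => //.
      by rewrite /unit_frac ltrN2 v1 oppr_le0.
    by rewrite rmorphB /=; lra.
  rewrite subr_eq0 => /eqP Nm; rewrite -Nm; split=> //; exists bs => //.
  by move: E; rewrite Nm; lra.
have f_digits m r : f m r != 0 -> exists2 bs, digits_ok p c bs & r = - digval p bs.
  by rewrite /f; case: ifP => [/andP [frr _] /(supp m r frr) []|_] //; rewrite eqxx.
have coef_ex m : exists e : 'rV[K]_n, - b <= m ->
    forall z, T_set p c z -> fm x a m z = \sum_(i < n) e 0 i * g i z.
  have [mb|_] := boolP (- b <= m); last by exists 0.
  have [e eP] := gP m mb; exists (\row_i e i) => _ z Tz.
  by rewrite eP //; apply: eq_bigr => i _; rewrite mxE.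
pose cf m := projT1 (cid (coef_ex m)).
have cfP m : - b <= m -> forall z, T_set p c z -> fm x a m z = \sum_(i < n) cf m 0 i * g i z.
  by rewrite /cf; case: cid.
(* The [g i] need not satisfy any recurrence, and their supports are arbitrary. Finitely many of the
   [f m] span the others, and these have recurrences and supports controlled by [x]. *)
have [ms [msP msgen]] := finite_basis (fun m => - b <= m) cf.
pose mj (j : 'I_(size ms)) := nth 0 ms j.
have mjb j : - b <= mj j.
  have key (s : seq int) i : (i < size s)%N -> List.In (nth 0 s i) s.
    by elim: s i => // y s IHs [|i] /=; [left | right; apply: IHs].
  by apply: msP; apply: key.
have f_span m : - b <= m -> exists e : 'I_(size ms) -> K,
    forall r, f m r = \sum_j e j * f (mj j) r.
  move=> mb.
  have := @coord_span _ _ _ (map_tuple cf (in_tuple ms)) _ (msgen m mb).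
  set e := coord _ => E; exists (fun j => e j (cf m)) => r.
  have [Tr|nT] := pselect (T_set p c r); last first.
    have z m' : f m' r = 0.
      apply/eqP/negPn/negP => nz; apply: nT.
      have [bs ok rE] := f_digits _ _ nz; move: nz; rewrite /f.
      case: ifP => [/andP [/andP [r1 r0] rn0] _|]; last by rewrite eqxx.
      split; last by rewrite r1 lt_neqAle rn0.
      by exists 0, bs; rewrite oppr0 sub0r divr1.
    by rewrite z big1 // => j _; rewrite z mulr0.
  have fE m' : - b <= m' -> f m' r = \sum_(i < n) cf m' 0 i * g i r.
    move=> m'b; rewrite -cfP // /f; case: Tr => _ [r1 r0].
    by rewrite /unit_frac r1 ltW // lt_eqF.
  rewrite fE // {1}E; under [RHS]eq_bigr => j _ do rewrite fE ?mjb // mulr_sumr.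
  rewrite [RHS]exchange_big; apply: eq_bigr => i _ /=.
  rewrite summxE mulr_suml; apply: eq_bigr => j _.
  by rewrite (nth_map 0) // mxE mulrA.
have rec_ex m : exists kd : nat * (nat -> K), - b <= m ->
    (exists l, (l <= kd.1)%N /\ kd.2 l != 0) /\
    forall u r, digits u -> unit_frac r ->
      \sum_(l < kd.1.+1) kd.2 l * f m (prep p u (r / p%:R ^+ l)) ^+ (p ^ l) = 0.
  have [mb|_] := boolP (- b <= m); last by exists (0%N, fun=> 0).
  have [k [_ [d [d_nz drec]]]] := rec m mb; exists (k, d) => _; split=> //.
  by apply: (twist_recurrent_prep _ (f_digits m) drec).
pose kd m := projT1 (cid (rec_ex m)).
have kdP m : - b <= m ->
    (exists l, (l <= (kd m).1)%N /\ (kd m).2 l != 0) /\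
    forall u r, digits u -> unit_frac r ->
      \sum_(l < (kd m).1.+1) (kd m).2 l * f m (prep p u (r / p%:R ^+ l)) ^+ (p ^ l) = 0.
  by rewrite /kd; case: cid.
pose L := (\max_j (c.+1 * (kd (mj j)).1.+1))%N.
pose V (i : option ('I_(size ms) * L.-bseq 'I_p)) : rat -> K :=
  if i is Some (j, w) then theta_word (map val w) (f (mj j))
  else fun r => (r == 0)%:R.
have word_span j u : digits u -> span V (theta_word u (f (mj j))).
  have [d_nz drec] := kdP _ (mjb j).
  apply: (theta_word_span (f_digits (mj j)) d_nz drec (L := L)).
    exact: (@leq_bigmax _ (fun j => c.+1 * (kd (mj j)).1.+1)%N j).
  move=> u' du' uL; have [w wE] := lift_word du' uL.
  by have := span_gen V (Some (j, w)); rewrite /V wE.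
have bsP (w : L.-bseq 'I_p) : digits (map val w).
  by apply/allP => y /mapP [i _ ->]; exact: ltn_ord.
apply: (@system_integral _ _ charp a x _ V a0).
- split.
    case=> [[j w]|] r; rewrite /V; first by rewrite /theta_word; case: ifP => //; rewrite eqxx.
    have [->|r0] := eqVneq r 0; first by [].
    by rewrite eqxx.
  case=> [[j w]|] b' bp.
    apply: span_ext (word_span j (rcons (map val w) b') _) => [r|].
      by rewrite /= theta_theta_word.
    by rewrite all_rcons bp bsP.
  (* The function supported at 0 is fixed by [theta 0]; the other operators kill it, since
     [(r - b) / p = 0] would give [r = b > 0]. *)
  case: b' bp => [|b'] bp.
    apply: span_ext (span_gen V None) => r; rewrite /= /theta subr0.
    have pQ : (p%:R : rat)^-1 != 0 by rewrite invr_eq0 pnatr_eq0 -lt0n.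
    rewrite mulf_eq0 (negPf pQ) orbF; have [->|_] := eqVneq r 0; first by rewrite expr1n.
    by rewrite expr0n gtn_eqF //; case: ifP.
  apply: span0 => r; rewrite /= /theta; case: ifP => // /andP [_ r0].
  rewrite mulf_eq0 invr_eq0 pnatr_eq0 (gtn_eqF p_gt0) orbF subr_eq0 lt_eqF ?expr0n ?gtn_eqF //.
  by apply: le_lt_trans r0 _; rewrite ltr0n.
- case=> [[j w]|]; last first.
    apply: (@well_ordered_single 0) => r; rewrite /hsupp /=.
    by have [->|] := eqVneq r 0; rewrite ?eqxx.
  (* Prepending digits is increasing in [r], so the support of each word lies in the preimage of the
     support of [x] under an increasing map. *)
  apply: well_ordered_sub (well_ordered_preim (g := fun r =>
      ((mj j)%:~R + prep p (map val w) r) / a%:R) _ (@hahn_well_ordered _ x)).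
    move=> r; rewrite /hsupp /= /theta_word; case: ifP => _; last by rewrite eqxx.
    rewrite expf_eq0 expn_gt0 p_gt0 /= /f; case: ifP => _ //; by rewrite eqxx.
  move=> r s; rewrite ler_pM2r ?invr_gt0 ?ltr0n // lerD2l; exact: prep_mono.
move=> m; have [mb|mb] := boolP (- b <= m); last first.
  apply: span0 => r; rewrite /component; case: ifP => // frr.
  by apply/eqP/negPn/negP => /(supp m r frr) [h _]; rewrite h in mb.
have [e eP] := f_span m mb.
have sp j : span V (f (mj j)).
  apply: span_ext (word_span j [::] isT) => r; rewrite /theta_word /= expn0 expr1.
  by case: ifP => // nf; rewrite /f nf.
have := spanD (span_sum (index_enum _) e sp)
  (span_sum [:: tt] (fun=> x (m%:~R / a%:R)) (fun _ => span_gen V None)).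
apply: span_ext => r; rewrite -eP big_seq1 /= /f /component.
case: ifP => [/andP [-> r0]|]; first by rewrite (negPf r0) mulr0 addr0.
have [->|r0] := eqVneq r 0; first by rewrite add0r mulr1 addr0.
by rewrite andbT => ->; rewrite mulr0 addr0.
Qed.

End WordKernels.

Theorem theorem11p12 (p : nat) (K : closedFieldType) (x : rat -> K) :
  prime p -> is_alg_closure_Fp p K -> well_ordered_supp x ->
  (integral_over_laurent x <-> twist_recurrent p x).
Proof.
move=> _ algK wx; have [charp _] := algK.
split=> [ix|tx].
  exact: (finite_kernel_twist_recurrent algK (integral_finite_kernel charp (x := mkhahn wx) ix)).
exact: (twist_recurrent_integral charp (x := mkhahn wx) tx).
Qed.
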